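(* Let $F(x)=\mathbb{E}_{z\sim p(z)}[\tilde F(x;z)]$, where the distribution $p(z)$ does not depend on $x$, and assume (O1)–(O3) in the context. Run the oblivious variant of 1-SFW described in the context for $T$ iterations. The constants hidden in $\mathcal{O}(\cdot)$ do not depend on $T$ (only on the problem parameters $D,R,B,G,L$). 1. If $F$ is convex on $\mathcal{K}$ and the minimization version is run with $\rho_t=(t-1)^{-1}$ (for $t\ge 2$) and $\eta_t=t^{-1}$, then $x_{T+1}\in\mathcal{K}$ and $\mathbb{E}[F(x_{T+1})-F(x^* )]\le\mathcal{O}(T^{-1/2})$, where $x^*$ is a minimizer of $F$ on $\mathcal{K}$. 2. If $F$ is non-convex and the minimization version is run with $\rho_t=(t-1)^{-2/3}$ (for $t\ge2$) and $\eta_t=T^{-2/3}$, and $x_o$ is chosen uniformly at random from $\{x_1,\dots,x_T\}$, then $x_o\in\mathcal{K}$ and $\mathbb{E}[\mathcal{G}(x_o)]\le\mathcal{O}(T^{-1/3})$, where $\mathcal{G}(x)=\max_{v\in\mathcal{K}}\langle v-x,-\nabla F(x)\rangle$. 3. If $F$ is monotone DR-submodular on the positive orthant, and the maximization version is run with $x_1=0\in\mathcal{K}$, $\rho_t=(t-1)^{-1}$ (for $t\ge2$) and $\eta_t=T^{-1}$, then $x_{T+1}\in\mathcal{K}$ and $\mathbb{E}[F(x_{T+1})]\ge(1-e^{-1})F(x^* )-\mathcal{O}(T^{-1/2})$, where $x^*$ is a maximizer of $F$ on $\mathcal{K}$.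
   Context: Norms are Euclidean; gradients are with respect to $x$. $\mathcal{K}\subseteq\mathbb{R}^d$ is convex, $\tilde F:\mathbb{R}^d\times\mathcal{Z}\to\mathbb{R}$. Assumptions: (O1) $\mathcal{K}$ is compact with diameter $D=\max_{x,y\in\mathcal{K}}\|x-y\|$ and radius $R=\max_{x\in\mathcal{K}}\|x\|$. (O2) $|\tilde F(x;z)|\le B$ for all $x\in\mathcal{K}$, $z\in\mathcal{Z}$. (O3) $\|\nabla\tilde F(x;z)\|\le G$ and $\|\nabla\tilde F(x;z)-\nabla\tilde F(y;z)\|\le L\|x-y\|$ for all $x,y\in\mathcal{K}$, $z\in\mathcal{Z}$. DR-submodularity (part 3): $\mathcal{K}\subseteq[0,\infty)^d$; a continuous nonnegative function $F$ on the positive orthant is DR-submodular if it is differentiable and $\nabla F(x)\ge\nabla F(y)$ (coordinatewise) whenever $x\le y$ (coordinatewise); it is monotone if $F(x)\le F(y)$ whenever $x\le y$. Oblivious 1-SFW: start from $x_1\in\mathcal{K}$. For $t=1,\dots,T$: sample $z_t\sim p(z)$ independently. If $t=1$ set $d_1=\nabla\tilde F(x_1;z_1)$. If $t\ge2$ set $\tilde\Delta_t=\nabla\tilde F(x_t;z_t)-\nabla\tilde F(x_{t-1};z_t)$ and $d_t=(1-\rho_t)(d_{t-1}+\tilde\Delta_t)+\rho_t\nabla\tilde F(x_t;z_t)$. Minimization version: $v_t\in\arg\min_{v\in\mathcal{K}}v^\top d_t$, $x_{t+1}=x_t+\eta_t(v_t-x_t)$. Maximization version: $v_t\in\arg\max_{v\in\mathcal{K}}v^\top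 d_t$, $x_{t+1}=x_t+\eta_tv_t$. *)

(* Defs.v *)
From HB Require Import structures.
From mathcomp Require Import all_boot all_order all_algebra.
From mathcomp Require Import all_classical all_reals all_analysis.

Set Implicit Arguments.
Unset Strict Implicit.
Unset Printing Implicit Defensive.

Import Order.TTheory GRing.Theory Num.Theory.
Import numFieldNormedType.Exports.

Local Open Scope classical_set_scope.
Local Open Scope ring_scope.

Definition dot (R : realType) (d : nat) (u v : 'rV[R]_d) : R :=
  \sum_(i < d) u 0 i * v 0 i.

(* The library norm on ['rV[R]_d] is the sup norm; it induces the same topology
   (hence the same notions of compactness and differentiability) as the
   Euclidean norm, but quantitative bounds must use the latter. *)
Definition enorm (R : realType) (d : nat) (u : 'rV[R]_d) : R :=
  Num.sqrt (dot u u).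

(* Meaningful at points where [f] is [differentiable]. *)
Definition grad (R : realType) (d : nat) (f : 'rV[R]_d -> R) (x : 'rV[R]_d) :
    'rV[R]_d :=
  \row_(i < d) 'D_(delta_mx 0 i) f x.

Definition is_max (R : realType) (S : set R) (m : R) : Prop :=
  S m /\ ubound S m.

Definition minimizer (T : Type) (R : realType) (K : set T) (F : T -> R) (x : T) :
    Prop :=
  K x /\ forall y, K y -> F x <= F y.

Definition maximizer (T : Type) (R : realType) (K : set T) (F : T -> R) (x : T) :
    Prop :=
  K x /\ forall y, K y -> F y <= F x.

(* [F x = E_{z ~ p} Ft x z]; on the constraint set the integrand is bounded
   and measurable, so the expectation is finite there. *)
Definition mean_objective (R : realType) (d : nat) (dZ : measure_display)
    (Z : measurableType dZ) (p : probability Z R) (Ft : 'rV[R]_d -> Z -> R)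
    (x : 'rV[R]_d) : R :=
  fine 'E_p[Ft x].

(* The last three fields say that each [Ft ^~ z] has, at every point of [K], a
   (two-sided) gradient, bounded by [G] and [L]-Lipschitz on [K]. *)
Record stochastic_problem (R : realType) (d : nat) (dZ : measure_display)
    (Z : measurableType dZ) (K : set 'rV[R]_d) (Ft : 'rV[R]_d -> Z -> R)
    (D Rad B G L : R) : Prop := StochasticProblem {
  domain_convex : convex_set (K : set (convex_lmodType 'rV[R]_d));
  domain_compact : compact K;
  domain_diameter : is_max [set enorm (x - y) | x in K & y in K] D;
  domain_radius : is_max [set enorm x | x in K] Rad;
  sample_measurable : forall x, measurable_fun [set: Z] (Ft x);
  sample_bounded : forall x z, K x -> `|Ft x z| <= B;
  sample_differentiable : forall x z, K x -> differentiable (Ft ^~ z) x;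
  sample_grad_bounded : forall x z, K x -> enorm (grad (Ft ^~ z) x) <= G;
  sample_grad_lipschitz : forall x y z, K x -> K y ->
    enorm (grad (Ft ^~ z) x - grad (Ft ^~ z) y) <= L * enorm (x - y)
}.

(* The sigma-algebra generated by the samples [z s] and the oracle answers
   [v s] of the iterations [1 <= s < t]; the random vectors [v s] are handled
   through their coordinates. *)
Definition history (R : realType) (d : nat) (dO dZ : measure_display)
    (Omega : measurableType dO) (Z : measurableType dZ)
    (z : nat -> Omega -> Z) (v : nat -> Omega -> 'rV[R]_d) (t : nat) :
    set (set Omega) :=
  <<s [set E | exists s, (1 <= s < t)%N /\
         ((exists A : set Z, measurable A /\ E = z s @^-1` A) \/
          (exists i (A : set R), measurable A /\
             E = (fun w => v s w 0 i) @^-1` A))] >>.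

(* Each [z t] has law [p] and is independent of everything that happened before
   iteration [t]; in particular the samples are mutually independent.  The
   oracle answers [v t] may be any random vectors: a measurable function of
   the past, or one that breaks ties with additional randomness. *)
Record iid_sampling (R : realType) (d : nat) (dO dZ : measure_display)
    (Omega : measurableType dO) (Z : measurableType dZ)
    (P : probability Omega R) (p : probability Z R) (T : nat)
    (z : nat -> {RV P >-> Z}) (v : nat -> Omega -> 'rV[R]_d) : Prop :=
  IidSampling {
  oracle_measurable : forall t i, (1 <= t <= T)%N ->
    measurable_fun [set: Omega] (fun w => v t w 0 i);
  sampling_law : forall t (A : set Z), (1 <= t <= T)%N -> measurable A ->
    distribution P (z t) A = p A;
  sampling_independent : forall t (A : set Z) (H : set Omega),
    (1 <= t <= T)%N -> measurable A -> history z v t H ->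
    P (z t @^-1` A `&` H) = (P (z t @^-1` A) * P H)%E
}.

(* Iterations are numbered from [1]: index [0] of [z], [v], [x] and [g] is
   never used.  [g t] is the gradient estimate of iteration [t]. *)
Record sfw_estimator (R : realType) (d : nat) (Omega Z : Type)
    (Ft : 'rV[R]_d -> Z -> R) (rho : nat -> R) (T : nat) (x1 : 'rV[R]_d)
    (z : nat -> Omega -> Z) (x g : nat -> Omega -> 'rV[R]_d) : Prop :=
  SfwEstimator {
  sfw_start : forall w, x 1%N w = x1;
  sfw_first_estimate : forall w, g 1%N w = grad (Ft ^~ (z 1%N w)) (x 1%N w);
  sfw_estimate : forall t w, (2 <= t <= T)%N ->
    let Delta :=
      grad (Ft ^~ (z t w)) (x t w) - grad (Ft ^~ (z t w)) (x t.-1 w) in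
    g t w = (1 - rho t) *: (g t.-1 w + Delta)
            + rho t *: grad (Ft ^~ (z t w)) (x t w)
}.

Record sfw_min_run (R : realType) (d : nat) (Omega Z : Type)
    (K : set 'rV[R]_d) (Ft : 'rV[R]_d -> Z -> R) (rho eta : nat -> R)
    (T : nat) (x1 : 'rV[R]_d) (z : nat -> Omega -> Z)
    (v x g : nat -> Omega -> 'rV[R]_d) : Prop := SfwMinRun {
  sfw_min_estimator : sfw_estimator Ft rho T x1 z x g;
  sfw_min_oracle : forall t w, (1 <= t <= T)%N ->
    minimizer K (fun u => dot u (g t w)) (v t w);
  sfw_min_step : forall t w, (1 <= t <= T)%N ->
    x t.+1 w = x t w + eta t *: (v t w - x t w)
}.

Record sfw_max_run (R : realType) (d : nat) (Omega Z : Type)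
    (K : set 'rV[R]_d) (Ft : 'rV[R]_d -> Z -> R) (rho eta : nat -> R)
    (T : nat) (x1 : 'rV[R]_d) (z : nat -> Omega -> Z)
    (v x g : nat -> Omega -> 'rV[R]_d) : Prop := SfwMaxRun {
  sfw_max_estimator : sfw_estimator Ft rho T x1 z x g;
  sfw_max_oracle : forall t w, (1 <= t <= T)%N ->
    maximizer K (fun u => dot u (g t w)) (v t w);
  sfw_max_step : forall t w, (1 <= t <= T)%N ->
    x t.+1 w = x t w + eta t *: v t w
}.

(* [o] is uniform on [{1, ..., T}] and independent of the whole run, so that
   [x (o w) w] is an iterate chosen uniformly at random. *)
Record uniform_index (R : realType) (d : nat) (dO dZ : measure_display)
    (Omega : measurableType dO) (Z : measurableType dZ)
    (P : probability Omega R) (T : nat) (z : nat -> Omega -> Z)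
    (v : nat -> Omega -> 'rV[R]_d) (o : {RV P >-> nat}) : Prop :=
  UniformIndex {
  index_range : forall w, (1 <= o w <= T)%N;
  index_uniform : forall t, (1 <= t <= T)%N ->
    P (o @^-1` [set t]) = (T%:R^-1)%:E;
  index_independent : forall t (H : set Omega), history z v T.+1 H ->
    P (o @^-1` [set t] `&` H) = (P (o @^-1` [set t]) * P H)%E
}.

(* For compact [K] the supremum is a maximum. *)
Definition fw_gap (R : realType) (d : nat) (K : set 'rV[R]_d)
    (F : 'rV[R]_d -> R) (x : 'rV[R]_d) : R :=
  sup [set dot (v - x) (- grad F x) | v in K].

Definition vle (R : realType) (d : nat) (x y : 'rV[R]_d) : Prop :=
  forall i, x 0 i <= y 0 i.

Definition orthant (R : realType) (d : nat) : set 'rV[R]_d :=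
  [set x | vle 0 x].

(* [F] is differentiable at [x] as a function on [A], with gradient [g]: the
   values of [F] outside [A] play no role.  For [A] the orthant, [g] is unique,
   and it is the usual gradient when [x] is an interior point. *)
Definition has_gradient_within (R : realType) (d : nat) (A : set 'rV[R]_d)
    (F : 'rV[R]_d -> R) (x g : 'rV[R]_d) : Prop :=
  (F y - F x - dot g (y - x)) / enorm (y - x) @[y --> within A x^'] --> (0 : R).

Definition DR_submodular (R : realType) (d : nat) (F : 'rV[R]_d -> R) : Prop :=
  [/\ {within @orthant R d, continuous F},
      forall x, orthant x -> 0 <= F x &
      exists gF : 'rV[R]_d -> 'rV[R]_d,
        (forall x, orthant x -> has_gradient_within (@orthant R d) F x (gF x)) /\
        (forall x y, orthant x -> orthant y -> vle x y -> vle (gF y) (gF x))].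

Definition monotone_on_orthant (R : realType) (d : nat) (F : 'rV[R]_d -> R) :
    Prop :=
  forall x y, orthant x -> orthant y -> vle x y -> F x <= F y.

(* Main.v *)
Require Import Defs.
From HB Require Import structures.
From mathcomp Require Import all_boot all_order all_algebra.
From mathcomp Require Import all_classical all_reals all_analysis.
From mathcomp Require Import measurable_realfun ring lra.

Set Implicit Arguments.
Unset Strict Implicit.
Unset Printing Implicit Defensive.

Import Order.TTheory GRing.Theory Num.Theory.
Import numFieldNormedType.Exports.

Local Open Scope classical_set_scope.
Local Open Scope ring_scope.

(** The algorithm follows an estimate [g t] of the mean gradient at [x t].  The
    error of this estimate satisfies
      [err t = (1 - rho t) *: err t.-1 + innovation t],
    where the innovation is built from the fresh sample and therefore integrates
    to zero over every event of the past ([noise_past_centered]).  Past error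
    and innovation are thus orthogonal ([mean_err_innovation]) and their mean
    squares add up.  Consecutive iterates are [O(rho t)] apart and the sample
    gradients are Lipschitz, so the mean square of the innovation is
    [O(rho t ^+ 2)], which gives ([mse_rec])
      [mse t <= (1 - rho t) ^+ 2 * mse t.-1 + kappa * rho t ^+ 2].
    With [rho t = 1 / (t - 1)] this is [O(1 / t)] ([inverse_rate]), and with
    [rho t = (t - 1)^(-2/3)] it is [O(t^(-2/3))] ([two_thirds_rate]).

    Conditional expectations are not constructed.  A function of the fresh
    sample and of an iterate is reduced to functions of the sample alone by
    replacing the iterate by one of finitely many values, chosen by a past
    event ([exists_discretization]); the Lipschitz dependence on the iterate
    makes the error of this replacement uniformly small.  The same device gives
    joint measurability ([caratheodory_measurable]) and the vanishing of the
    product with a past variable ([mean_mul_centered]).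

    The objective is never differentiated under the integral sign.  Averaging
    the expansions of the samples shows that, between two points of the domain,
    the objective agrees with its linearization by the mean gradient up to
    [`|L|] times the squared distance ([objective_expansion]).  Hence the mean
    gradient computes every derivative of the objective in a direction that
    stays in the domain ([directional_derivative_unique]), and the analysis of
    the runs only involves such directions.

    It remains to run the deterministic Frank-Wolfe argument.  One step
    makes as much progress as a step whose oracle knows the mean gradient, up to
    a quadratic term and the product of the error with a difference of two
    points of the domain, which Young's inequality bounds by the squared error
    ([frank_wolfe_min_step], [frank_wolfe_max_step]).  Then
    - for convex [F], the tangent inequality gives
      [t * e t.+1 <= (t - 1) * e t + O(t^(-1/2))] for the mean suboptimality
      [e] ([decreasing_step_rate]);
    - for differentiable [F], the gap at [x t] is at most a past variable
      ([gap_bound]) whose mean telescopes over [t], and the independent uniform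
      index turns the mean at the random iterate into an average over [t];
    - for monotone DR-submodular [F], concavity along nonnegative directions
      gives [e t.+1 <= (1 - 1 / T) * e t + O(T^(-1) * t^(-1/2))], and
      [(1 - 1 / T) ^+ T <= expR (- 1)] ([constant_step_rate]). *)

(** * Euclidean geometry of row vectors *)

Section euclidean.
Context (R : realType) (n : nat).
Implicit Types (u v w : 'rV[R]_n) (a c : R).

Lemma dotC u v : dot u v = dot v u.
Proof. by apply: eq_bigr => i _; rewrite mulrC. Qed.

Lemma dotDl u v w : dot (u + v) w = dot u w + dot v w.
Proof. by rewrite -big_split; apply: eq_bigr => i _; rewrite mxE mulrDl. Qed.

Lemma dotZl a u v : dot (a *: u) v = a * dot u v.
Proof. by rewrite big_distrr; apply: eq_bigr => i _ /=; rewrite mxE mulrA. Qed.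

Lemma dotNl u v : dot (- u) v = - dot u v.
Proof. by rewrite -scaleN1r dotZl mulN1r. Qed.

Lemma dotBl u v w : dot (u - v) w = dot u w - dot v w.
Proof. by rewrite dotDl dotNl. Qed.

Lemma dotDr u v w : dot u (v + w) = dot u v + dot u w.
Proof. by rewrite dotC dotDl !(dotC u). Qed.

Lemma dotZr a u v : dot u (a *: v) = a * dot u v.
Proof. by rewrite dotC dotZl dotC. Qed.

Lemma dotNr u v : dot u (- v) = - dot u v.
Proof. by rewrite dotC dotNl dotC. Qed.

Lemma dotBr u v w : dot u (v - w) = dot u v - dot u w.
Proof. by rewrite dotDr dotNr. Qed.

Lemma dot_ge0 u : 0 <= dot u u.
Proof. by apply: sumr_ge0 => i _; rewrite -expr2 sqr_ge0. Qed.

Lemma enorm_ge0 u : 0 <= enorm u.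
Proof. exact: sqrtr_ge0. Qed.

Lemma sqr_enorm u : enorm u ^+ 2 = dot u u.
Proof. by rewrite sqr_sqrtr// dot_ge0. Qed.

Lemma enormZ a u : enorm (a *: u) = `|a| * enorm u.
Proof.
by rewrite /enorm dotZl dotZr mulrA -expr2 sqrtrM ?sqr_ge0// sqrtr_sqr.
Qed.

Lemma dot_eq0 u : dot u u = 0 -> u = 0.
Proof.
move=> /eqP; rewrite psumr_eq0; last by move=> i _; rewrite -expr2 sqr_ge0.
move=> /allP u0; apply/rowP => i; rewrite mxE; apply/eqP.
by have := u0 i (mem_index_enum _); rewrite implyTb mulf_eq0 orbb.
Qed.

Lemma sqr_dot_le u v : dot u v ^+ 2 <= dot u u * dot v v.
Proof.
have [/dot_eq0 ->|v0] := eqVneq (dot v v) 0.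
  by rewrite -(scale0r v) !dotZr !mul0r expr0n mulr0.
have vp : 0 < dot v v by rewrite lt_neqAle eq_sym v0 dot_ge0.
have := dot_ge0 (dot v v *: u - dot u v *: v).
rewrite !(dotBl, dotBr, dotZl, dotZr) (dotC v u) => h.
rewrite -subr_ge0 -(pmulr_rge0 _ vp); apply: le_trans h _.
by rewrite le_eqVlt; apply/orP; left; apply/eqP; ring.
Qed.

Lemma normr_dot_le u v : `|dot u v| <= enorm u * enorm v.
Proof.
rewrite -(ler_sqr (x := `|dot u v|)) ?nnegrE ?mulr_ge0 ?enorm_ge0//.
by rewrite real_normK ?num_real// exprMn !sqr_enorm sqr_dot_le.
Qed.

(** Young's inequality trades the product of two norms for squared norms, whose
    means obey a recursion, and thereby avoids square roots of random
    quantities. *)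
Lemma dot_young c u v : 0 < c -> dot u v <= (c * dot u u + dot v v / c) / 2.
Proof.
move=> c0; have := dot_ge0 (c *: u - v).
rewrite !(dotBl, dotBr, dotZl, dotZr) (dotC v u) => h.
rewrite -(ler_pM2l c0) -subr_ge0.
have -> : c * ((c * dot u u + dot v v / c) / 2) - c * dot u v =
   (c * (c * dot u u) - c * dot u v - (c * dot u v - dot v v)) / 2.
  by field; rewrite gt_eqF.
by lra.
Qed.

Lemma dot_add_le u v : dot (u + v) (u + v) <= 2 * dot u u + 2 * dot v v.
Proof.
have := dot_ge0 (u - v).
by rewrite !(dotBl, dotBr, dotDl, dotDr) (dotC v u); lra.
Qed.

Lemma normr_coord_le u i : `|u 0 i| <= enorm u.
Proof.
rewrite -(ler_sqr (x := `|u 0 i|)) ?nnegrE ?enorm_ge0//.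
rewrite real_normK ?num_real// sqr_enorm /dot (bigD1 i)//= -expr2 lerDl.
by apply: sumr_ge0 => j _; rewrite -expr2 sqr_ge0.
Qed.

Lemma enorm_le_coord u c : 0 <= c -> (forall i, `|u 0 i| <= c) ->
  enorm u <= n%:R * c.
Proof.
move=> c0 uc; rewrite -(ler_sqr (x := enorm u)) ?nnegrE ?enorm_ge0 ?mulr_ge0//.
rewrite sqr_enorm (@le_trans _ _ (n%:R * c ^+ 2))//.
  have -> : n%:R * c ^+ 2 = \sum_(i < n) c ^+ 2.
    by rewrite sumr_const card_ord mulr_natl.
  apply: ler_sum => i _.
  by rewrite -expr2 -real_normK ?num_real// lerXn2r ?nnegrE.
rewrite exprMn ler_wpM2r ?sqr_ge0// -natrX ler_nat.
by case: (n) => // m; rewrite expnS leq_pmulr ?expn1.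
Qed.

Lemma dot_le_sqr u c : enorm u <= c -> dot u u <= c ^+ 2.
Proof.
move=> uc; rewrite -sqr_enorm lerXn2r ?nnegrE ?enorm_ge0//.
exact: le_trans (enorm_ge0 u) uc.
Qed.

End euclidean.

(** * Bounded measurable functions and their means *)

Definition mean (R : realType) d (T : measurableType d) (P : probability T R)
  (f : T -> R) : R := fine 'E_P[f].

(** All random quantities of a run are bounded, because the domain and the
    gradients are; bounded measurable functions form an algebra on which the
    mean is finite and linear. *)
Definition bounded_measurable (R : realType) d (T : measurableType d)
    (f : T -> R) : Prop :=
  measurable_fun [set: T] f /\ exists M, forall w, `|f w| <= M.

Section bounded_measurable.
Context (R : realType) d (T : measurableType d).
Implicit Types f g : T -> R.

Lemma bounded_measurable_cst c : bounded_measurable (fun _ : T => c : R).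
Proof. by split; [exact: measurable_cst|exists `|c|]. Qed.

Lemma bounded_measurableD f g : bounded_measurable f -> bounded_measurable g ->
  bounded_measurable (fun w => f w + g w).
Proof.
move=> [mf [M fM]] [mg [N gN]]; split; first exact: measurable_funD.
by exists (M + N) => w; rewrite (le_trans (ler_normD _ _))// lerD.
Qed.

Lemma bounded_measurableM f g : bounded_measurable f -> bounded_measurable g ->
  bounded_measurable (fun w => f w * g w).
Proof.
move=> [mf [M fM]] [mg [N gN]]; split; first exact: measurable_funM.
by exists (M * N) => w; rewrite normrM ler_pM.
Qed.

Lemma bounded_measurableZ c f : bounded_measurable f ->
  bounded_measurable (fun w => c * f w).
Proof. by apply: bounded_measurableM; exact: bounded_measurable_cst. Qed.

Lemma bounded_measurableN f : bounded_measurable f ->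
  bounded_measurable (fun w => - f w).
Proof.
by move=> /(bounded_measurableZ (-1)); under eq_fun do rewrite mulN1r.
Qed.

Lemma bounded_measurableB f g : bounded_measurable f -> bounded_measurable g ->
  bounded_measurable (fun w => f w - g w).
Proof. by move=> bf /bounded_measurableN; exact: bounded_measurableD. Qed.

Lemma bounded_measurable_sum (I : Type) (s : seq I) (f : I -> T -> R) :
  (forall i, bounded_measurable (f i)) ->
  bounded_measurable (fun w => \sum_(i <- s) f i w).
Proof.
move=> bf; elim: s => [|i s ih].
  by under eq_fun do rewrite big_nil; exact: bounded_measurable_cst.
by under eq_fun do rewrite big_cons; exact: bounded_measurableD.
Qed.

Lemma bounded_measurable_indic (A : set T) : measurable A ->
  bounded_measurable (\1_A : T -> R).
Proof.
move=> mA; split; first exact: measurable_indic.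
by exists 1 => w; rewrite indicE ger0_norm// lern1 leq_b1.
Qed.

End bounded_measurable.

Lemma bounded_measurable_comp (R : realType) d d' (T : measurableType d)
    (Y : measurableType d') (h : T -> Y) (f : Y -> R) :
  measurable_fun [set: T] h -> bounded_measurable f ->
  bounded_measurable (fun w => f (h w)).
Proof.
move=> mh [mf [M fM]]; split; last by exists M => w.
exact: measurableT_comp.
Qed.

Section mean.
Context (R : realType) d (T : measurableType d) (P : probability T R).
Implicit Types f g : T -> R.

Lemma bounded_measurable_integrable f :
  bounded_measurable f -> P.-integrable [set: T] (EFin \o f).
Proof.
move=> [mf [M fM]]; apply: measurable_bounded_integrable => //.
  by apply: le_lt_trans (probability_le1 _ _) _; rewrite ?ltry.
exists M; split; first exact: num_real.
by move=> N MN w _ /=; rewrite (le_trans (fM w))// ltW.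
Qed.

Lemma bounded_measurable_Lfun1 f : bounded_measurable f -> f \in Lfun P 1.
Proof. by move=> bf; exact/Lfun1_integrable/bounded_measurable_integrable. Qed.

Lemma meanE f : bounded_measurable f -> 'E_P[f]%E = (mean P f)%:E.
Proof.
by move=> bf; rewrite /mean fineK// expectation_fin_num//;
  exact: bounded_measurable_Lfun1.
Qed.

Lemma meanD f g : bounded_measurable f -> bounded_measurable g ->
  mean P (fun w => f w + g w) = mean P f + mean P g.
Proof.
move=> bf bg; rewrite /mean.
rewrite (@expectationD _ _ _ _ f g) ?bounded_measurable_Lfun1//.
by rewrite fineD// expectation_fin_num// bounded_measurable_Lfun1.
Qed.

Lemma meanZ c f : bounded_measurable f ->
  mean P (fun w => c * f w) = c * mean P f.
Proof.
move=> bf; rewrite /mean.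
have -> : (fun w => c * f w) = c \o* f by apply/funext => w /=; rewrite mulrC.
rewrite expectationZl ?bounded_measurable_Lfun1//.
by rewrite fineM// expectation_fin_num// bounded_measurable_Lfun1.
Qed.

Lemma meanB f g : bounded_measurable f -> bounded_measurable g ->
  mean P (fun w => f w - g w) = mean P f - mean P g.
Proof.
move=> bf bg; rewrite (meanD bf (bounded_measurableN bg)).
by under eq_fun do rewrite -mulN1r; rewrite meanZ// mulN1r.
Qed.

Lemma mean_cst c : mean P (fun=> c) = c.
Proof. by rewrite /mean expectation_cst. Qed.

Lemma mean_sum (I : Type) (s : seq I) (f : I -> T -> R) :
  (forall i, bounded_measurable (f i)) ->
  mean P (fun w => \sum_(i <- s) f i w) = \sum_(i <- s) mean P (f i).
Proof.
move=> bf; elim: s => [|i s ih].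
  by under eq_fun do rewrite big_nil; rewrite mean_cst big_nil.
under eq_fun do rewrite big_cons.
by rewrite meanD ?ih ?big_cons//; exact: bounded_measurable_sum.
Qed.

Lemma mean_ge0 f : (forall w, 0 <= f w) -> 0 <= mean P f.
Proof. by move=> f0; rewrite /mean fine_ge0// expectation_ge0. Qed.

Lemma le_mean f g : bounded_measurable f -> bounded_measurable g ->
  (forall w, f w <= g w) -> mean P f <= mean P g.
Proof.
move=> bf bg fg; rewrite -subr_ge0 -meanB//.
by apply: mean_ge0 => w; rewrite subr_ge0.
Qed.

Lemma normr_mean_le f c : bounded_measurable f -> (forall w, `|f w| <= c) ->
  `|mean P f| <= c.
Proof.
move=> bf fc; have bc := @bounded_measurable_cst R _ T.
rewrite ler_norml; apply/andP; split.
  rewrite -(mean_cst (- c)); apply: le_mean => // w.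
  by have := fc w; rewrite ler_norml => /andP[].
rewrite -[leRHS](mean_cst c); apply: le_mean => // w.
by have := fc w; rewrite ler_norml => /andP[].
Qed.

End mean.

Section restricted_law.
Context (R : realType) d d' (T : measurableType d) (Y : measurableType d').
Context (P : probability T R).

(** The law of [f] under the restriction of [P] to [A] is [c] times its law
    under [P], so integrals against the two laws are proportional.  With [A] an
    event of the past and [f] the fresh sample, or with [A] a value of the
    random index and [f] the identity onto the past, the proportionality is
    an independence assumption. *)
Lemma ge0_mean_indic_comp (f : T -> Y) (A : set T) (c : {nonneg R})
    (phi : Y -> R) :
  measurable_fun [set: T] f -> measurable A ->
  (forall B, measurable B -> P (f @^-1` B `&` A) = c%:num%:E * P (f @^-1` B))%E ->
  bounded_measurable phi -> (forall y, 0 <= phi y) ->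
  mean P (fun w => \1_A w * phi (f w)) = c%:num * mean P (fun w => phi (f w)).
Proof.
move=> mf mA fA bphi phi0.
have bphif := bounded_measurable_comp mf bphi.
have mphi := (bphi.1).
have mE (h : Y -> R) : measurable_fun setT h ->
  measurable_fun setT (EFin \o h) by move=> mh; exact/measurable_EFinP.
have mEf (h : T -> R) : measurable_fun setT h ->
  measurable_fun setT (EFin \o h) by move=> mh; exact/measurable_EFinP.
have mean1 : ('E_P[(fun w => \1_A w * phi (f w))%R] =
    c%:num%:E * 'E_P[(fun w => phi (f w))])%E.
  rewrite unlock.
  transitivity (\int[P]_(w in A) (phi (f w))%:E)%E.
    rewrite [RHS]integral_mkcond; apply: eq_integral => w _.
    rewrite patchE indicE; case: ifPn => _ /=; rewrite ?mul1r ?mul0r//.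
  transitivity (\int[mrestr P mA]_w (phi (f w))%:E)%E.
    rewrite [RHS](@ge0_negligible_integral _ _ _ _ _ (~` A))//.
    - rewrite setTD setCK; apply: eq_measure_integral => /= B mB BA.
      by rewrite /mrestr setIidl.
    - exact: measurableC.
    - exact: (mEf _ bphif.1).
    - by move=> w _; rewrite lee_fin.
    - by rewrite /= /mrestr setICl measure0.
  have := @ge0_integral_pushforward _ _ _ _ _ f mf (mrestr P mA) setT (EFin \o phi).
  rewrite preimage_setT => /(_ measurableT (mE _ mphi)) <-; last first.
    by move=> y _; rewrite /= lee_fin.
  have := @ge0_integral_pushforward _ _ _ _ _ f mf (mscale c P) setT (EFin \o phi).
  rewrite preimage_setT => /(_ measurableT (mE _ mphi)) push2.
  rewrite -(@ge0_integral_mscale _ _ _ P setT measurableT c (EFin \o (phi \o f)))//.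
  - rewrite -push2; last by move=> y _; rewrite /= lee_fin.
    apply: eq_measure_integral => B mB _.
    exact: fA.
  - exact: (mEf _ bphif.1).
  - by move=> y _; rewrite /= lee_fin.
by rewrite /mean mean1 fineM//= meanE.
Qed.

(** Adding a constant to [phi] reduces to the nonnegative case; the constant
    itself is covered by that case too. *)
Lemma mean_indic_comp (f : T -> Y) (A : set T) (c : R) (phi : Y -> R) :
  measurable_fun [set: T] f -> measurable A -> 0 <= c ->
  (forall B, measurable B -> P (f @^-1` B `&` A) = c%:E * P (f @^-1` B))%E ->
  bounded_measurable phi ->
  mean P (fun w => \1_A w * phi (f w)) = c * mean P (fun w => phi (f w)).
Proof.
move=> mf mA c0 fA bphi; have [mphi [M phiM]] := bphi.
pose psi y := phi y + M.
have bpsi : bounded_measurable psi.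
  exact/(bounded_measurableD bphi)/bounded_measurable_cst.
have psi0 y : 0 <= psi y.
  by have := phiM y; rewrite ler_norml /psi => /andP[]; lra.
have M0 : bounded_measurable (fun _ : Y => `|M|) by exact: bounded_measurable_cst.
have E1 := @ge0_mean_indic_comp f A (NngNum c0) psi mf mA fA bpsi psi0.
have E2 := @ge0_mean_indic_comp f A (NngNum c0) (fun=> 1) mf mA fA
  (bounded_measurable_cst _ 1) (fun=> ler01).
have b1 := @bounded_measurable_indic R _ _ _ mA.
have bphif := bounded_measurable_comp mf bphi.
have -> : (fun w => \1_A w * phi (f w)) =
    (fun w => \1_A w * psi (f w) - M * (\1_A w * 1)).
  by apply/funext => w; rewrite /psi; ring.
have E3 : mean P (fun w => psi (f w)) = mean P (fun w => phi (f w)) + M.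
  by rewrite meanD ?mean_cst//; exact: bounded_measurable_cst.
rewrite meanB ?meanZ ?E1 ?E2 ?E3 ?mean_cst /=; first by ring.
- by apply: bounded_measurableM => //; exact: bounded_measurable_cst.
- by apply: bounded_measurableM => //; exact: bounded_measurable_comp.
- apply: bounded_measurableZ.
  by apply: bounded_measurableM => //; exact: bounded_measurable_cst.
Qed.

End restricted_law.

(** * Discretization, measurability and conditional centering *)

Section discretization.
Context (R : realType) d (T : measurableType d).

Lemma sum_fibers (J : finType) (key : T -> J) (f : J -> T -> R) w :
  f (key w) w = \sum_j \1_(key @^-1` [set j]) w * f j w.
Proof.
rewrite (bigD1 (key w))//= indicE mem_set// mul1r big1 ?addr0// => j jw.
rewrite indicE memNset ?mul0r//= => kw.
by move: jw; rewrite -kw eqxx.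
Qed.

Lemma bounded_measurable_fibers (J : finType) (key : T -> J) (f : J -> T -> R) :
  (forall j, measurable (key @^-1` [set j])) ->
  (forall j, bounded_measurable (f j)) ->
  bounded_measurable (fun w => f (key w) w).
Proof.
move=> mk bf; under eq_fun do rewrite (sum_fibers key).
apply: bounded_measurable_sum => j; apply: bounded_measurableM => //.
exact: bounded_measurable_indic.
Qed.

(** The key of a point records the comparisons of its coordinates with all
    levels of a grid of mesh [delta].  Two points with the same key have close
    coordinates, and every fiber of the key is a finite intersection of
    measurable sets.  The representative of a fiber is one of its points, so it
    keeps any constraint satisfied by all the values of [X]. *)
Lemma exists_discretization n (X : T -> 'rV[R]_n) (M delta : R) :
  0 < delta -> (forall i, measurable_fun [set: T] (fun w => X w 0 i)) ->
  (forall w i, `|X w 0 i| <= M) ->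
  exists (J : finType) (key : T -> J) (rep : J -> T),
    (forall j, measurable (key @^-1` [set j])) /\
    (forall w i, `|X w 0 i - X (rep (key w)) 0 i| <= delta).
Proof.
move=> delta0 mX XM; pose N := (Num.truncn (2 * M / delta)).+1.
pose level (k : nat) : R := - M + k%:R * delta.
pose key w := [ffun p : 'I_n * 'I_N => level p.2 <= X w 0 p.1].
have key_close w w' i : key w = key w' -> X w 0 i <= X w' 0 i + delta.
  move=> kk; rewrite leNgt; apply/negP => far.
  (* the highest level below [X w 0 i] separates it from [X w' 0 i] *)
  pose y := (X w 0 i + M) / delta.
  have wM := XM w i; have w'M := XM w' i.
  have y0 : 0 <= y.
    apply: divr_ge0; last exact: ltW.
    by move: wM; rewrite ler_norml => /andP[]; lra.
  have kN : (Num.truncn y < N)%N.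
    rewrite ltnS; apply: le_truncn; rewrite ler_pM2r ?invr_gt0//.
    by move: wM; rewrite ler_norml => /andP[]; lra.
  have /ffunP/(_ (i, Ordinal kN)) := kk; rewrite !ffunE /= /level.
  have /andP[y1 y2] := truncn_itv y0.
  have yE : y * delta = X w 0 i + M by rewrite divfK// gt_eqF.
  have y1d : (Num.truncn y)%:R * delta <= y * delta by rewrite ler_pM2r.
  have y2d : y * delta < (Num.truncn y).+1%:R * delta by rewrite ltr_pM2r.
  have -> : - M + (Num.truncn y)%:R * delta <= X w 0 i by lra.
  move=> /esym; rewrite -/(is_true _) => y3.
  by move: y2d; rewrite -natr1 mulrDl mul1r; lra.
pose rep j := xget point (key @^-1` [set j]).
have repK w : key (rep (key w)) = key w.
  by have := @xgetPex _ point (key @^-1` [set key w]); apply; exists w.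
exists {ffun 'I_n * 'I_N -> bool}, key, rep; split => [j|w i]; last first.
  have k1 := key_close w (rep (key w)) i (esym (repK w)).
  have k2 := key_close (rep (key w)) w i (repK w).
  by rewrite ler_norml; apply/andP; split; lra.
have -> : key @^-1` [set j] = \bigcap_(q in [set: 'I_n * 'I_N])
    [set w | (level q.2 <= X w 0 q.1) = j q].
  apply/seteqP; split => w /=.
    by move=> <- q _ /=; rewrite ffunE.
  by move=> kw; apply/ffunP => q; rewrite ffunE; exact: kw.
apply: fin_bigcap_measurable => // q _.
have mlevel : measurable [set w | level q.2 <= X w 0 q.1].
  have := mX q.1 measurableT `[level q.2, +oo[%classic (measurable_itv _).
  rewrite setTI; congr (measurable _); apply/seteqP; split => w /=;
  by rewrite in_itv/= andbT.
case: (j q) => //.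
have -> : [set w | (level q.2 <= X w 0 q.1) = false] =
    ~` [set w | level q.2 <= X w 0 q.1].
  by apply/seteqP; split => w /= => [->//|/negP/negbTE].
exact: measurableC.
Qed.

End discretization.

Section caratheodory.
Context (R : realType) d d' (T : measurableType d) (Z : measurableType d').
Context (n : nat) (K : set 'rV[R]_n) (M c : R) (psi : 'rV[R]_n -> Z -> R).
Hypothesis KM : forall x i, K x -> `|x 0 i| <= M.
Hypothesis psi_measurable : forall x, K x -> measurable_fun [set: Z] (psi x).
Hypothesis psi_lipschitz : forall x y z, K x -> K y ->
  `|psi x z - psi y z| <= c * enorm (x - y).

(** Replacing [X] by its discretization yields finite combinations of
    measurable functions that converge uniformly, by the Lipschitz property. *)
Lemma caratheodory_measurable (X : T -> 'rV[R]_n) (zeta : T -> Z) :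
  (forall w, K (X w)) ->
  (forall i, measurable_fun [set: T] (fun w => X w 0 i)) ->
  measurable_fun [set: T] zeta ->
  measurable_fun [set: T] (fun w => psi (X w) (zeta w)).
Proof.
move=> KX mX mzeta.
have approx m : exists h : T -> R, measurable_fun [set: T] h /\
    forall w, `|psi (X w) (zeta w) - h w| <= `|c| * n%:R * m.+1%:R^-1.
  have [J [key [rep [mkey close]]]] :=
    @exists_discretization R _ T _ X M m.+1%:R^-1 ltac:(by [])
      mX (fun w i => KM i (KX w)).
  exists (fun w => psi (X (rep (key w))) (zeta w)); split.
    under eq_fun do
      rewrite (sum_fibers key (fun j w => psi (X (rep j)) (zeta w))).
    apply: measurable_sum => j; apply: measurable_funM.
      exact: measurable_indic.
    exact/(measurableT_comp _ mzeta)/psi_measurable.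
  move=> w; apply: le_trans (psi_lipschitz _ (KX _) (KX _)) _.
  apply: (@le_trans _ _ (`|c| * enorm (X w - X (rep (key w))))).
    by rewrite ler_wpM2r ?enorm_ge0// ler_norm.
  rewrite -mulrA ler_wpM2l//; apply: enorm_le_coord => // i.
  by rewrite !mxE.
have [h hP] := choice approx.
apply: (@measurable_fun_cvg _ _ _ _ h) => [m|w _]; first exact: (hP m).1.
apply/cvgrPdist_le => e e0; near=> m.
apply: le_trans ((hP m).2 w) _.
have C0 : 0 <= `|c| * n%:R by rewrite mulr_ge0.
rewrite ler_pdivrMr// [e * _]mulrC -ler_pdivrMr//.
have : `|c| * n%:R / e <= m%:R by near: m; exact: nbhs_infty_ger.
by move=> h1; apply: le_trans h1 _; rewrite ler_nat.
Unshelve. all: by end_near. Qed.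

End caratheodory.

Section conditional_centering.
Context (R : realType) d (T : measurableType d) (P : probability T R).
Context (G : set (set T)).
Hypothesis G_measurable : <<s G >> `<=` @measurable _ T.

(** That is, [U] has conditional expectation zero given the sigma-algebra
    generated by [G]. *)
Definition centered (U : T -> R) : Prop :=
  forall H, <<s G >> H -> mean P (fun w => \1_H w * U w) = 0.

Lemma sub_measurable_fun d' (Y : measurableType d') (f : T -> Y) :
  measurable_fun [set: g_sigma_algebraType G] f -> measurable_fun [set: T] f.
Proof. by move=> mf _ B mB; apply: G_measurable; exact: mf. Qed.

Lemma sub_bounded_measurable (f : T -> R) :
  @bounded_measurable R _ (g_sigma_algebraType G) f -> bounded_measurable f.
Proof. by move=> [mf bf]; split => //; exact: sub_measurable_fun. Qed.

Lemma eq0_of_normr_le_small (x c : R) :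
  (forall delta, 0 < delta -> `|x| <= c * delta) -> x = 0.
Proof.
move=> small; apply/eqP; rewrite -normr_eq0; apply/eqP/le_anti.
rewrite normr_ge0 andbT; apply/ler_addgt0Pr => e e0; rewrite add0r.
have c1 : 0 < `|c| + 1 by rewrite ltr_pwDr.
apply: le_trans (small _ (divr_gt0 e0 c1)) _.
rewrite mulrCA -[leRHS]mulr1 ler_pM2l// ler_pdivrMr// mul1r.
by rewrite (le_trans (ler_norm _))// lerDl.
Qed.

(** For a [Y] with finitely many values, the product is a combination of
    integrals of [U] over events generated by [G]; any bounded [Y] is a uniform
    limit of such functions. *)
Lemma mean_mul_centered (Y U : T -> R) :
  @bounded_measurable R _ (g_sigma_algebraType G) Y ->
  bounded_measurable U -> centered U -> mean P (fun w => Y w * U w) = 0.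
Proof.
move=> bY bU cU; have [mY [M YM]] := bY; have [_ [C UC]] := bU.
apply: (@eq0_of_normr_le_small _ C) => delta delta0.
(* the discretization applies to vectors: view [Y] as one of dimension 1 *)
pose X w : 'rV[R]_1 := const_mx (Y w).
have mX i : measurable_fun [set: g_sigma_algebraType G] (fun w => X w 0 i).
  by under eq_fun do rewrite /X mxE.
have XM w i : `|X w 0 i| <= M by rewrite /X mxE; exact: YM.
have [J [key [rep [mkey close]]]] :=
  @exists_discretization R _ (g_sigma_algebraType G) 1%N X M delta delta0 mX XM.
pose Yd (w : T) := Y (rep (key w)).
have mkeyT j : @measurable _ T (key @^-1` [set j]).
  by apply: G_measurable; exact: mkey.
have bYd : bounded_measurable Yd.
  apply: (@bounded_measurable_fibers _ _ T J key (fun j _ => Y (rep j))) => //.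
  by move=> j; exact: bounded_measurable_cst.
have bY' := sub_bounded_measurable bY.
have Yd0 : mean P (fun w => Yd w * U w) = 0.
  under eq_fun do
    rewrite /Yd (sum_fibers key (fun j _ => Y (rep j))) mulr_suml.
  rewrite mean_sum => [|j]; last first.
    apply: bounded_measurableM => //; apply: bounded_measurableM => //.
      exact: bounded_measurable_indic.
    exact: bounded_measurable_cst.
  rewrite big1// => j _; under eq_fun do rewrite mulrAC mulrC.
  rewrite meanZ; last first.
    by apply: bounded_measurableM => //; exact: bounded_measurable_indic.
  by rewrite cU ?mulr0//; exact: mkey.
rewrite -[mean P _]subr0 -Yd0 -meanB; do ?exact: bounded_measurableM.
apply: normr_mean_le => [|w].
  by apply: bounded_measurableB; exact: bounded_measurableM.
rewrite -mulrBl normrM mulrC ler_pM//.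
by have := close w 0; rewrite !mxE.
Qed.

End conditional_centering.

Section independent_sample.
Context (R : realType) d d' (T : measurableType d) (Z : measurableType d').
Context (P : probability T R) (p : probability Z R) (G : set (set T)).
Hypothesis G_measurable : <<s G >> `<=` @measurable _ T.
Context (zeta : {RV P >-> Z}).
Hypothesis zeta_law : forall A, measurable A -> distribution P zeta A = p A.
Hypothesis zeta_independent : forall A H, measurable A -> <<s G >> H ->
  P (zeta @^-1` A `&` H) = (P (zeta @^-1` A) * P H)%E.

Lemma mean_sample (phi : Z -> R) : bounded_measurable phi ->
  mean P (fun w => phi (zeta w)) = mean p phi.
Proof.
move=> bphi; have mzeta : measurable_fun [set: T] zeta by [].
rewrite /mean unlock; congr (fine _).
transitivity (\int[distribution P zeta]_y (phi y)%:E)%E.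
  rewrite integral_distribution//; first exact/measurable_EFinP/bphi.1.
  exact/(bounded_measurable_integrable P)/(bounded_measurable_comp mzeta).
by apply: eq_measure_integral => A mA _; exact: zeta_law.
Qed.

(** Freezing the past variable [X] at one of finitely many values on a past
    event [H `&` Hj] leaves a function of the sample, whose integral over that
    event is [P (H `&` Hj)] times its mean, hence zero. *)
Lemma centered_sample n (K : set 'rV[R]_n) (M c C : R)
    (psi : 'rV[R]_n -> Z -> R) (X : T -> 'rV[R]_n) :
  (forall x i, K x -> `|x 0 i| <= M) ->
  (forall x, K x -> measurable_fun [set: Z] (psi x)) ->
  (forall x z, K x -> `|psi x z| <= C) ->
  (forall x y z, K x -> K y -> `|psi x z - psi y z| <= c * enorm (x - y)) ->
  (forall x, K x -> mean p (psi x) = 0) ->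
  (forall w, K (X w)) ->
  (forall i, measurable_fun [set: g_sigma_algebraType G] (fun w => X w 0 i)) ->
  centered P G (fun w => psi (X w) (zeta w)).
Proof.
move=> KM mpsi psiC psiL psi0 KX mX H GH.
have mH : measurable H by exact: G_measurable.
have mzeta : measurable_fun [set: T] zeta by [].
have bpsi x : K x -> bounded_measurable (psi x).
  by move=> Kx; split; [exact: mpsi|exists C => z; exact: psiC].
have bpsiX : bounded_measurable (fun w => psi (X w) (zeta w)).
  split; last by exists C => w; exact: psiC.
  apply: (caratheodory_measurable KM mpsi psiL) => // i.
  exact: sub_measurable_fun (mX i).
have b1H := bounded_measurable_indic R mH.
apply: (@eq0_of_normr_le_small _ _ (`|c| * n%:R)) => delta delta0.
have [J [key [rep [mkey close]]]] :=
  @exists_discretization R _ (g_sigma_algebraType G) n X M delta delta0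
    mX (fun w i => KM _ i (KX w)).
have mkeyT j : @measurable _ T (key @^-1` [set j]).
  by apply: G_measurable; exact: mkey.
pose U (w : T) := psi (X (rep (key w))) (zeta w).
have bpsij j : bounded_measurable (fun w => psi (X (rep j)) (zeta w)).
  exact/(bounded_measurable_comp mzeta)/bpsi.
have bU : bounded_measurable U.
  exact: (@bounded_measurable_fibers _ _ T J key
    (fun j w => psi (X (rep j)) (zeta w))).
have U0 : mean P (fun w => \1_H w * U w) = 0.
  under eq_fun do rewrite /U
    (sum_fibers key (fun j w => psi (X (rep j)) (zeta w))) mulr_sumr.
  rewrite mean_sum => [|j]; last first.
    apply: bounded_measurableM => //; apply: bounded_measurableM => //.
    exact: bounded_measurable_indic.
  rewrite big1// => j _; pose Hj : set T := key @^-1` [set j].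
  have mHHj : @measurable _ T (H `&` Hj) by exact: measurableI mH (mkeyT j).
  have GHHj : <<s G >> (H `&` Hj).
    exact: (@measurableI _ (g_sigma_algebraType G) _ _ GH (mkey j)).
  transitivity (mean P (fun w => \1_(H `&` Hj) w * psi (X (rep j)) (zeta w))).
    by congr (mean P _); apply/funext => w; rewrite mulrA indicI.
  rewrite (@mean_indic_comp _ _ _ _ _ _ zeta _ (fine (P (H `&` Hj))))//.
  - by rewrite mean_sample ?psi0 ?mulr0//; exact: bpsi.
  - by rewrite fine_ge0.
  - move=> B mB; rewrite fineK ?fin_num_measure//.
    by rewrite zeta_independent// muleC.
  - exact: bpsi.
rewrite -[mean P _]subr0 -U0 -meanB; do ?exact: bounded_measurableM.
apply: normr_mean_le => [|w].
  by apply: bounded_measurableB; exact: bounded_measurableM.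
rewrite -mulrBr normrM -[leRHS]mul1r ler_pM//.
  by rewrite indicE ger0_norm// lern1 leq_b1.
apply: le_trans (psiL _ _ _ (KX _) (KX _)) _.
apply: (@le_trans _ _ (`|c| * enorm (X w - X (rep (key w))))).
  by rewrite ler_wpM2r ?enorm_ge0// ler_norm.
rewrite -mulrA ler_wpM2l//; apply: enorm_le_coord; first exact: ltW.
by move=> i; rewrite !mxE.
Qed.

End independent_sample.

(** * The stochastic objective *)

Section directional.
Context (R : realType) (n : nat).
Implicit Types (f : 'rV[R]_n -> R) (x u : 'rV[R]_n).

Lemma derive_grad f x u : differentiable f x -> 'D_u f x = dot (grad f x) u.
Proof.
move=> df; rewrite deriveE// [in LHS](row_sum_delta u) linear_sum.
by apply: eq_bigr => i _; rewrite linearZ /= mxE deriveE// mulrC.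
Qed.

(** The difference quotients of the restriction to the line at [s] are the
    difference quotients of [f] in the direction [u]. *)
Lemma is_derive_line f x u (s : R) : differentiable f (x + s *: u) ->
  is_derive s 1 (fun t : R => f (x + t *: u)) (dot (grad f (x + s *: u)) u).
Proof.
move=> df; rewrite -derive_grad//.
have E : (fun h : R => h^-1 *:
    (((fun t : R => f (x + t *: u)) \o shift s) (h *: 1) - f (x + s *: u))) =
  (fun h : R => h^-1 *:
    ((f \o shift (x + s *: u)) (h *: u) - f (x + s *: u))).
  apply/funext => h /=; congr (_ *: (f _ - _)).
  by rewrite scalerDl addrCA [h *: 1]mulr1.
apply: DeriveDef; last by rewrite /derive E.
by rewrite /derivable E; exact: diff_derivable.
Qed.

End directional.

Section mean_vector.
Context (R : realType) d (Z : measurableType d) (p : probability Z R) (n : nat).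
Implicit Types V W : Z -> 'rV[R]_n.

Definition mean_vector V : 'rV[R]_n := \row_i mean p (fun z => V z 0 i).

Lemma mean_dot V u : (forall i, bounded_measurable (fun z => V z 0 i)) ->
  mean p (fun z => dot (V z) u) = dot (mean_vector V) u.
Proof.
move=> bV; rewrite mean_sum => [|i]; last first.
  by under eq_fun do rewrite mulrC; exact: bounded_measurableZ.
apply: eq_bigr => i _; rewrite mxE mulrC.
by under eq_fun do rewrite mulrC; exact: meanZ.
Qed.

Lemma bounded_measurable_dot V u : (forall i, bounded_measurable (fun z => V z 0 i)) ->
  bounded_measurable (fun z => dot (V z) u).
Proof.
move=> bV; apply: bounded_measurable_sum => i.
by under eq_fun do rewrite mulrC; exact: bounded_measurableZ.
Qed.

(** Jensen's inequality for the norm: test the mean against itself. *)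
Lemma enorm_mean_vector V c : (forall i, bounded_measurable (fun z => V z 0 i)) ->
  (forall z, enorm (V z) <= c) -> enorm (mean_vector V) <= c.
Proof.
move=> bV Vc; set m := mean_vector V.
have c0 : 0 <= c by exact: le_trans (enorm_ge0 (V point)) (Vc _).
have [->//|m0] := eqVneq (enorm m) 0.
have mp : 0 < enorm m by rewrite lt_neqAle eq_sym m0 enorm_ge0.
rewrite -(ler_pM2r mp) -expr2 sqr_enorm -mean_dot// -(mean_cst p (c * enorm m)).
apply: le_mean => [||z].
- exact: bounded_measurable_dot.
- exact: bounded_measurable_cst.
- apply: le_trans (ler_norm _) _; apply: le_trans (normr_dot_le _ _) _.
  by rewrite ler_pM2r.
Qed.

Lemma mean_vectorB V W : (forall i, bounded_measurable (fun z => V z 0 i)) ->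
  (forall i, bounded_measurable (fun z => W z 0 i)) ->
  mean_vector (fun z => V z - W z) = mean_vector V - mean_vector W.
Proof.
move=> bV bW; apply/rowP => i; rewrite !mxE -meanB//.
by congr (mean p _); apply/funext => z; rewrite !mxE.
Qed.

End mean_vector.

Section problem.
Context (R : realType) (n : nat) d (Z : measurableType d).
Context (p : probability Z R) (K : set 'rV[R]_n) (Ft : 'rV[R]_n -> Z -> R).
Context (D Rad B G L : R).
Hypothesis prob : stochastic_problem K Ft D Rad B G L.

Let F := mean_objective p Ft.

Definition sample_grad (x : 'rV[R]_n) (z : Z) := grad (Ft ^~ z) x.

Definition mean_grad (x : 'rV[R]_n) := mean_vector p (sample_grad x).

Lemma segment_domain x y (h : R) : K x -> K y -> 0 <= h <= 1 ->
  K (x + h *: (y - x)).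
Proof.
move=> Kx Ky /andP[h0 h1].
have h01 : Itv.spec (@Itv.num_sem R) (Itv.Real `[0%Z, 1%Z]) h.
  by rewrite /Itv.spec/= /Itv.num_sem/= in_itv/= h0 h1 ger0_real.
have := domain_convex prob (Itv.mk h01) (mem_set Ky) (mem_set Kx).
rewrite inE; congr K.
by rewrite /conv/= /unstable.onem scalerBl scalerBr scale1r addrC -addrA [- _ + _]addrC.
Qed.

Lemma domain_coord x i : K x -> `|x 0 i| <= Rad.
Proof.
move=> Kx; apply: le_trans (normr_coord_le x i) _.
by apply: (domain_radius prob).2; exists x.
Qed.

Lemma domain_norm x : K x -> enorm x <= Rad.
Proof. by move=> Kx; apply: (domain_radius prob).2; exists x. Qed.

Lemma domain_dist x y : K x -> K y -> enorm (x - y) <= D.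
Proof.
by move=> Kx Ky; apply: (domain_diameter prob).2; exists x => //; exists y.
Qed.

Lemma diameter_ge0 : 0 <= D.
Proof.
by have [[x Kx [y Ky <-]] _] := domain_diameter prob; exact: enorm_ge0.
Qed.

Lemma radius_ge0 : 0 <= Rad.
Proof. by have [[x Kx <-] _] := domain_radius prob; exact: enorm_ge0. Qed.

Lemma domain_inhabited : exists x, K x.
Proof. by have [[x Kx _] _] := domain_radius prob; exists x. Qed.

Lemma grad_bound_ge0 : 0 <= G.
Proof.
have [x Kx] := domain_inhabited.
exact: le_trans (enorm_ge0 _) (sample_grad_bounded prob point Kx).
Qed.

(** A partial derivative is the limit of the difference quotients with
    increments [1 / (m + 1)], each of which is measurable in the sample.  The
    points at which these quotients are evaluated may leave the domain, where
    the samples are still measurable. *)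
Lemma sample_grad_measurable x i : K x ->
  measurable_fun [set: Z] (fun z => sample_grad x z 0 i).
Proof.
move=> Kx; pose e : 'rV[R]_n := delta_mx 0 i.
pose quot (m : nat) z := m.+1%:R * (Ft (m.+1%:R^-1 *: e + x) z - Ft x z).
apply: (@measurable_fun_cvg _ _ _ _ quot) => [m|z _].
  apply: measurable_funM; first exact: measurable_cst.
  by apply: measurable_funB; exact: (sample_measurable prob).
rewrite /sample_grad mxE.
have dF : derivable (Ft ^~ z) x e.
  exact/diff_derivable/(sample_differentiable prob).
have : m.+1%:R^-1 @[m --> \oo] --> (0 : R)^'.
  move=> A [r /= r0 Ar]; have := @cvg_harmonic R.
  move=> /cvgrPdist_lt /(_ r r0); apply: filterS => m /=.
  by move=> /Ar; apply; rewrite invr_eq0 pnatr_eq0.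
move=> /(cvg_comp _ _)/(_ dF); rewrite /comp/=.
by under eq_fun do rewrite invrK.
Qed.

Lemma sample_grad_coord x z i : K x -> `|sample_grad x z 0 i| <= G.
Proof.
move=> Kx; apply: le_trans (normr_coord_le _ i) _.
exact: (sample_grad_bounded prob).
Qed.

Lemma bounded_measurable_sample_grad x i : K x ->
  bounded_measurable (fun z => sample_grad x z 0 i).
Proof.
move=> Kx; split; first exact: sample_grad_measurable.
by exists G => z; exact: sample_grad_coord.
Qed.

Lemma bounded_measurable_sample x : K x -> bounded_measurable (Ft x).
Proof.
move=> Kx; split; first exact: (sample_measurable prob).
by exists B => z; exact: (sample_bounded prob).
Qed.

Lemma enorm_mean_grad x : K x -> enorm (mean_grad x) <= G.
Proof.
move=> Kx; apply: enorm_mean_vector => [i|z].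
  exact: bounded_measurable_sample_grad.
exact: (sample_grad_bounded prob).
Qed.

Lemma mean_grad_lipschitz x y : K x -> K y ->
  enorm (mean_grad x - mean_grad y) <= L * enorm (x - y).
Proof.
move=> Kx Ky; have bg u i : K u -> bounded_measurable (fun z => sample_grad u z 0 i).
  exact: bounded_measurable_sample_grad.
rewrite -mean_vectorB; [|by move=> i; exact: bg..].
apply: enorm_mean_vector => [i|z]; last exact: (sample_grad_lipschitz prob).
rewrite (_ : (fun z => _) = fun z => sample_grad x z 0 i - sample_grad y z 0 i).
  by apply: bounded_measurableB; exact: bg.
by apply/funext => z; rewrite !mxE.
Qed.

(** By the mean value theorem the increment is the derivative at an
    intermediate point, and the gradient there differs from the one at [x] by at
    most [L] times the distance. *)
Lemma sample_expansion x y z : K x -> K y ->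
  `|Ft y z - Ft x z - dot (sample_grad x z) (y - x)|
    <= `|L| * dot (y - x) (y - x).
Proof.
move=> Kx Ky; pose u := y - x.
have Kseg (s : R) : 0 <= s <= 1 -> K (x + s *: u) by exact: segment_domain.
have dF (s : R) : 0 <= s <= 1 -> is_derive s 1 (fun t : R => Ft (x + t *: u) z)
    (dot (sample_grad (x + s *: u) z) u).
  move=> s01; apply: (@is_derive_line _ _ (Ft ^~ z)).
  exact/(sample_differentiable prob)/Kseg.
have [||s s01] := @MVT_segment R (fun t => Ft (x + t *: u) z)
    (fun s => dot (sample_grad (x + s *: u) z) u) 0 1 ler01.
- by move=> s; rewrite in_itv/= => /andP[s0 s1]; apply: dF; rewrite !ltW.
- apply: derivable_within_continuous => s; rewrite in_itv/= => s01.
  by have [] := dF s s01.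
rewrite in_itv/= in s01; have /andP[s0 s1] := s01.
rewrite scale1r scale0r addr0 subr0 mulr1 [x + u]addrC subrK => ->.
rewrite -dotBl; apply: le_trans (normr_dot_le _ _) _.
rewrite -sqr_enorm expr2 mulrA ler_wpM2r ?enorm_ge0//.
apply: le_trans (sample_grad_lipschitz prob z (Kseg _ s01) Kx) _.
rewrite addrC addKr enormZ ger0_norm// -/u.
apply: (@le_trans _ _ (`|L| * (s * enorm u))).
  by rewrite ler_wpM2r ?mulr_ge0 ?enorm_ge0 ?ler_norm.
by rewrite ler_wpM2l// ler_piMl ?enorm_ge0.
Qed.

Lemma objective_expansion x y : K x -> K y ->
  `|F y - F x - dot (mean_grad x) (y - x)| <= `|L| * dot (y - x) (y - x).
Proof.
move=> Kx Ky.
have bFx := bounded_measurable_sample Kx.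
have bFy := bounded_measurable_sample Ky.
have bg i := bounded_measurable_sample_grad i Kx.
have bgd := bounded_measurable_dot (y - x) bg.
rewrite -mean_dot// -(meanB p bFy bFx) -meanB//; last exact: bounded_measurableB.
apply: normr_mean_le => [|z]; last exact: sample_expansion.
exact/bounded_measurableB/bgd/bounded_measurableB.
Qed.

Lemma objective_bounded x : K x -> `|F x| <= B.
Proof.
move=> Kx; apply: normr_mean_le; first exact: bounded_measurable_sample.
by move=> z; exact: (sample_bounded prob).
Qed.

(** The quadratic term of the expansion is turned into a linear one by the
    bound [D] on distances. *)
Lemma objective_lipschitz x y : K x -> K y ->
  `|F x - F y| <= (G + `|L| * D) * enorm (x - y).
Proof.
move=> Kx Ky; have := objective_expansion Ky Kx.
have h1 : `|dot (mean_grad y) (x - y)| <= G * enorm (x - y).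
  apply: le_trans (normr_dot_le _ _) _.
  by rewrite ler_wpM2r ?enorm_ge0// enorm_mean_grad.
have h2 : `|L| * dot (x - y) (x - y) <= `|L| * D * enorm (x - y).
  rewrite -sqr_enorm expr2 mulrA ler_wpM2r ?enorm_ge0//.
  by rewrite ler_wpM2l// domain_dist.
rewrite mulrDl; move: h1; rewrite !ler_norml => /andP[? ?] /andP[? ?].
by apply/andP; split; lra.
Qed.

(** Only directions that stay in the domain determine the mean gradient: the
    expansion along a segment identifies its product with such a direction
    with any one-sided derivative of the objective. *)
Lemma directional_derivative_unique x y (a : R) : K x -> K y ->
  (F (x + h *: (y - x)) - F x) / h @[h --> 0^'+] --> a ->
  a = dot (mean_grad x) (y - x).
Proof.
move=> Kx Ky Fa; set u := y - x in Fa *; set b := dot _ _.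
have Fb : (F (x + h *: u) - F x) / h @[h --> 0^'+] --> b.
  apply/cvgrPdist_le => e e0.
  pose c := `|L| * dot u u + 1.
  have c0 : 0 < c by rewrite ltr_pwDr// mulr_ge0// dot_ge0.
  near=> h.
  have h0 : 0 < h by near: h; exact: nbhs_right_gt.
  have h1 : h <= 1 by near: h; exact: nbhs_right_le.
  have he : h <= e / c by near: h; apply: nbhs_right_le; rewrite divr_gt0.
  have Kh : K (x + h *: u) by apply: segment_domain => //; rewrite ltW.
  have := objective_expansion Kx Kh.
  have -> : x + h *: u - x = h *: u by rewrite addrC addKr.
  rewrite dotZr dotZl dotZr -/b => hb.
  have -> : b - (F (x + h *: u) - F x) / h =
      - ((F (x + h *: u) - F x - h * b) / h) by field; rewrite gt_eqF.
  rewrite normrN normrM normfV (gtr0_norm h0) ler_pdivrMr//.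
  apply: le_trans hb _; rewrite mulrCA [leRHS]mulrC ler_pM2l// mulrCA.
  rewrite ler_pdivlMr// in he; apply: le_trans he.
  by rewrite ler_pM2l// /c lerDl.
exact: (cvg_unique _ Fa Fb).
Unshelve. all: by end_near. Qed.

End problem.

(** * The error of the gradient estimator *)

Section noise.
Context (R : realType) (n : nat) d (Z : measurableType d).
Context (p : probability Z R) (K : set 'rV[R]_n) (Ft : 'rV[R]_n -> Z -> R).
Context (D Rad B G L : R).
Hypothesis prob : stochastic_problem K Ft D Rad B G L.

Definition noise (x : 'rV[R]_n) (z : Z) := sample_grad Ft x z - mean_grad p Ft x.

Lemma noise_coord x z i :
  noise x z 0 i = sample_grad Ft x z 0 i - mean_grad p Ft x 0 i.
Proof. by rewrite /noise; move: (sample_grad _ _ _) => a; rewrite !mxE. Qed.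

Lemma noise_measurable x i : K x ->
  measurable_fun [set: Z] (fun z => noise x z 0 i).
Proof.
move=> Kx; under eq_fun do rewrite noise_coord.
by apply: measurable_funB => //; exact: sample_grad_measurable prob _ _ Kx.
Qed.

Lemma noise_centered x i : K x -> mean p (fun z => noise x z 0 i) = 0.
Proof.
move=> Kx; under eq_fun do rewrite noise_coord.
rewrite meanB ?mean_cst.
- by rewrite [mean_grad p Ft x]/mean_grad mxE subrr.
- exact: bounded_measurable_sample_grad prob _ _ Kx.
- exact: bounded_measurable_cst.
Qed.

Lemma noise_sqr x z : K x -> dot (noise x z) (noise x z) <= 4 * G ^+ 2.
Proof.
move=> Kx; apply: le_trans (dot_add_le _ _) _; rewrite dotNl dotNr opprK.
have := dot_le_sqr (sample_grad_bounded prob z Kx).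
have := dot_le_sqr (enorm_mean_grad p prob Kx).
by rewrite -/(sample_grad Ft x z); lra.
Qed.

(** The increment of the noise is the difference of a gradient increment and
    its mean, both of which are Lipschitz. *)
Lemma noise_diff_sqr x y z : K x -> K y ->
  dot (noise x z - noise y z) (noise x z - noise y z)
    <= 4 * L ^+ 2 * dot (x - y) (x - y).
Proof.
move=> Kx Ky.
have -> : noise x z - noise y z = (sample_grad Ft x z - sample_grad Ft y z)
    - (mean_grad p Ft x - mean_grad p Ft y).
  by rewrite /noise !opprB addrACA [in RHS]addrACA [- sample_grad _ _ _ + _]addrC.
apply: le_trans (dot_add_le _ _) _; rewrite dotNl dotNr opprK.
have := dot_le_sqr (sample_grad_lipschitz prob z Kx Ky).
have := dot_le_sqr (mean_grad_lipschitz p prob Kx Ky).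
rewrite exprMn sqr_enorm -/(sample_grad Ft x z) -/(sample_grad Ft y z); lra.
Qed.

Lemma noise_coord_bounded x z i : K x -> `|noise x z 0 i| <= 2 * G.
Proof.
move=> Kx; have G0 := grad_bound_ge0 prob.
apply: le_trans (normr_coord_le _ i) _.
rewrite -(ler_sqr (x := enorm _)) ?nnegrE ?enorm_ge0 ?mulr_ge0//.
by rewrite sqr_enorm (le_trans (noise_sqr z Kx))// exprMn; lra.
Qed.

Lemma noise_coord_lipschitz x y z i : K x -> K y ->
  `|noise x z 0 i - noise y z 0 i| <= 2 * `|L| * enorm (x - y).
Proof.
move=> Kx Ky.
have -> : noise x z 0 i - noise y z 0 i = (noise x z - noise y z) 0 i.
  by move: (noise x z) (noise y z) => a b; rewrite !mxE.
apply: le_trans (normr_coord_le _ i) _.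
rewrite -(ler_sqr (x := enorm _)) ?nnegrE ?enorm_ge0 ?mulr_ge0 ?enorm_ge0//.
rewrite sqr_enorm (le_trans (noise_diff_sqr z Kx Ky))//.
by rewrite !exprMn sqr_enorm real_normK ?num_real//; lra.
Qed.

End noise.

Section history.
Context (R : realType) (n : nat) (dO dZ : measure_display)
  (Omega : measurableType dO).
Context (Z : measurableType dZ) (P : probability Omega R) (p : probability Z R).
Context (T : nat) (z : nat -> {RV P >-> Z}) (v : nat -> Omega -> 'rV[R]_n).

(** The generators of [history z v t], named so that the past can be used as a
    measurable space of its own. *)
Definition history_events (t : nat) : set (set Omega) :=
  [set E | exists s, (1 <= s < t)%N /\
    ((exists A : set Z, measurable A /\ E = z s @^-1` A) \/
     (exists i (A : set R), measurable A /\
        E = (fun w => v s w 0 i) @^-1` A))].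

Notation past t := (g_sigma_algebraType (history_events t)).

Lemma history_mono t t' d' (Y : measurableType d') (f : Omega -> Y) :
  (t <= t')%N -> measurable_fun [set: past t] f ->
  measurable_fun [set: past t'] f.
Proof.
move=> tt' mf _ A mA; have := mf measurableT A mA.
apply: sub_sigma_algebra2 => E [s [/andP[s1 st] h]]; exists s; split => //.
by rewrite s1 (leq_trans st).
Qed.

Lemma history_sample s t : (1 <= s < t)%N -> measurable_fun [set: past t] (z s).
Proof.
move=> st _ A mA; rewrite setTI; apply: sub_sigma_algebra.
by exists s; split => //; left; exists A.
Qed.

Lemma history_oracle s t i : (1 <= s < t)%N ->
  measurable_fun [set: past t] (fun w => v s w 0 i).
Proof.
move=> st _ A mA; rewrite setTI; apply: sub_sigma_algebra.
by exists s; split => //; right; exists i, A.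
Qed.

Hypothesis iid : iid_sampling p T z v.

Lemma history_measurable t : (t <= T.+1)%N ->
  <<s history_events t >> `<=` @measurable _ Omega.
Proof.
move=> tT; apply: smallest_sub; first exact: sigma_algebra_measurable.
move=> E [s [/andP[s1 st] [[A [mA ->]]|[i [A [mA ->]]]]]].
  exact: measurable_funPTI.
rewrite -[X in measurable X]setTI; apply: (oracle_measurable iid i) => //.
by rewrite s1 -ltnS (leq_trans st).
Qed.

End history.

Notation past z v t := (g_sigma_algebraType (history_events z v t)).

Section estimator_error.
Context (R : realType) (n : nat) (dO dZ : measure_display)
  (Omega : measurableType dO).
Context (Z : measurableType dZ) (P : probability Omega R) (p : probability Z R).
Context (K : set 'rV[R]_n) (Ft : 'rV[R]_n -> Z -> R) (D Rad B G L : R).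
Context (T : nat) (rho : nat -> R) (x1 : 'rV[R]_n).
Context (z : nat -> {RV P >-> Z}) (v x g : nat -> Omega -> 'rV[R]_n).
Hypothesis prob : stochastic_problem K Ft D Rad B G L.
Hypothesis iid : iid_sampling p T z v.
Hypothesis est : sfw_estimator Ft rho T x1 z x g.
Hypothesis xK : forall t w, (1 <= t <= T.+1)%N -> K (x t w).
Hypothesis x_past : forall t i, (1 <= t <= T.+1)%N ->
  measurable_fun [set: past z v t] (fun w => x t w 0 i).

Definition err t w := g t w - mean_grad p Ft (x t w).

(** What iteration [t] adds to the discounted error: the gradient correction and
    the fresh gradient, both centered at their means. *)
Definition innovation t w :=
  (1 - rho t) *: (noise p Ft (x t w) (z t w) - noise p Ft (x t.-1 w) (z t w))
  + rho t *: noise p Ft (x t w) (z t w).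

Lemma err1 w : err 1 w = noise p Ft (x 1 w) (z 1 w).
Proof. by rewrite /err (sfw_first_estimate est). Qed.

Lemma err_rec t w : (2 <= t <= T)%N ->
  err t w = (1 - rho t) *: err t.-1 w + innovation t w.
Proof.
move=> tT; rewrite /err (sfw_estimate est _ tT) /innovation /noise /sample_grad.
set a := grad _ (x t w); set b := grad _ (x t.-1 w).
set ma := mean_grad _ _ (x t w); set mb := mean_grad _ _ (x t.-1 w).
move: (g t.-1 w) a b ma mb => c a b ma mb.
by apply/rowP => i; rewrite !mxE; ring.
Qed.

Lemma innovation_coord t w i : innovation t w 0 i =
  (1 - rho t) * (noise p Ft (x t w) (z t w) 0 i
    - noise p Ft (x t.-1 w) (z t w) 0 i)
  + rho t * noise p Ft (x t w) (z t w) 0 i.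
Proof.
rewrite /innovation; set a := noise _ _ (x t w) _; set b := noise _ _ _ _.
by move: a b => a b; rewrite !mxE.
Qed.

(** The noise of sample [t] at an iterate [x s] with [s <= t] belongs to the
    past of iteration [t.+1]: the iterate is a past variable and the noise is
    Lipschitz in it. *)
Lemma noise_past s t i : (1 <= s <= T.+1)%N -> (1 <= t)%N -> (s <= t)%N ->
  @bounded_measurable R _ (past z v t.+1) (fun w => noise p Ft (x s w) (z t w) 0 i).
Proof.
move=> sT t1 st; split; last first.
  by exists (2 * G) => w; apply: (noise_coord_bounded p prob); exact: xK.
apply: (@caratheodory_measurable _ _ _ _ _ _ K Rad (2 * `|L|)
    (fun x z => noise p Ft x z 0 i)) => //.
- by move=> y j; exact: (domain_coord prob).
- by move=> y Ky; exact: (noise_measurable p prob).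
- by move=> y y' u Ky Ky'; exact: (noise_coord_lipschitz p prob).
- by move=> w; exact: xK.
- by move=> j; apply: (@history_mono _ _ _ _ _ _ _ _ _ s) => //;
    [exact: leqW|exact: x_past].
- by apply: history_sample; rewrite t1 ltnSn.
Qed.

Lemma innovation_past t i : (2 <= t <= T)%N ->
  @bounded_measurable R _ (past z v t.+1) (fun w => innovation t w 0 i).
Proof.
case: t => [//|[//|t]] /andP[_ tT].
have b1 := @noise_past t.+2 t.+2 i (leqW tT) isT (leqnn _).
have b2 := @noise_past t.+1 t.+2 i (ltnW (leqW tT)) isT (leqnSn _).
under eq_fun do rewrite innovation_coord.
exact: (bounded_measurableD (bounded_measurableZ _ (bounded_measurableB b1 b2))
  (bounded_measurableZ _ b1)).
Qed.

Lemma err_past t i : (1 <= t <= T)%N ->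
  @bounded_measurable R _ (past z v t.+1) (fun w => err t w 0 i).
Proof.
elim: t => // -[_ /= T1|t ih tT].
  by under eq_fun do rewrite err1; exact: noise_past.
have errE w : err t.+2 w 0 i =
    (1 - rho t.+2) * err t.+1 w 0 i + innovation t.+2 w 0 i.
  rewrite err_rec//=; move: (err _ _) (innovation _ _) => a b.
  by rewrite !mxE.
under eq_fun do rewrite errE.
have [me be] := ih (ltnW tT).
have be' : @bounded_measurable R _ (past z v t.+3) (fun w => err t.+1 w 0 i).
  by split => //; exact: history_mono me.
exact: (bounded_measurableD (bounded_measurableZ _ be')
  (@innovation_past t.+2 i tT)).
Qed.

Lemma err_bounded_measurable t i : (1 <= t <= T)%N ->
  bounded_measurable (fun w => err t w 0 i).
Proof.
move=> tT; apply: (@sub_bounded_measurable _ _ _ (history_events z v t.+1)).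
  by apply: history_measurable iid _ _; case/andP: tT.
exact: err_past.
Qed.

Lemma err_sqr_bounded_measurable t : (1 <= t <= T)%N ->
  bounded_measurable (fun w => dot (err t w) (err t w)).
Proof.
move=> tT; apply: bounded_measurable_sum => i.
by apply: bounded_measurableM; exact: err_bounded_measurable.
Qed.

Lemma noise_past_centered s t i : (1 <= s <= t)%N -> (1 <= t <= T)%N ->
  centered P (history_events z v t) (fun w => noise p Ft (x s w) (z t w) 0 i).
Proof.
move=> /andP[s1 st] tT; have /andP[t1 tT'] := tT.
have sT : (1 <= s <= T.+1)%N by rewrite s1 (leq_trans st)// ltnW.
apply: (@centered_sample _ _ _ _ _ P p _ _ _ _ _ _ K Rad (2 * `|L|) (2 * G)
    (fun x z => noise p Ft x z 0 i)).
- by apply: history_measurable iid _ _; exact: leqW.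
- by move=> A mA; exact: (sampling_law iid).
- by move=> A H mA HH; exact: (sampling_independent iid tT).
- by move=> y j; exact: (domain_coord prob).
- by move=> y Ky; exact: (noise_measurable p prob).
- by move=> y u Ky; exact: (noise_coord_bounded p prob).
- by move=> y y' u Ky Ky'; exact: (noise_coord_lipschitz p prob).
- by move=> y Ky; exact: (noise_centered p prob).
- by move=> w; exact: xK.
- by move=> j; apply: (@history_mono _ _ _ _ _ _ _ _ _ s) => //; exact: x_past.
Qed.

(** The innovation combines the noises at [x t] and [x t.-1]; both points are
    past variables, so both noises are centered given the past, to which the
    previous error belongs. *)
Lemma mean_err_innovation t : (2 <= t <= T)%N ->
  mean P (fun w => dot (err t.-1 w) (innovation t w)) = 0.
Proof.
case: t => [//|[//|t]] /andP[_ tT] /=.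
have tT1 : (t.+2 <= T.+1)%N by exact: leqW.
have sub := history_measurable iid tT1.
have subS : <<s history_events z v t.+3 >> `<=` @measurable _ Omega.
  exact: history_measurable iid _ _.
have be i := @err_past t.+1 i (ltnW tT).
have be' i : bounded_measurable (fun w => err t.+1 w 0 i).
  by apply: err_bounded_measurable; exact: ltnW.
have b1 i : bounded_measurable (fun w => noise p Ft (x t.+2 w) (z t.+2 w) 0 i).
  apply: sub_bounded_measurable subS _ _.
  by apply: noise_past => //=; exact: leqW.
have b2 i : bounded_measurable (fun w => noise p Ft (x t.+1 w) (z t.+2 w) 0 i).
  apply: sub_bounded_measurable subS _ _.
  by apply: noise_past => //=; exact/ltnW/leqW.
have c1 i := mean_mul_centered sub (be i) (b1 i)
  (@noise_past_centered t.+2 t.+2 i (leqnn _) tT).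
have c2 i := mean_mul_centered sub (be i) (b2 i)
  (@noise_past_centered t.+1 t.+2 i (ltnW (leqnn _)) tT).
have bI i : bounded_measurable (fun w => innovation t.+2 w 0 i).
  by apply: sub_bounded_measurable subS _ _; exact: innovation_past.
rewrite mean_sum => [|i]; last exact: bounded_measurableM.
rewrite big1// => i _.
have E w : err t.+1 w 0 i * innovation t.+2 w 0 i =
    (err t.+1 w 0 i * noise p Ft (x t.+2 w) (z t.+2 w) 0 i)
    - (1 - rho t.+2) * (err t.+1 w 0 i * noise p Ft (x t.+1 w) (z t.+2 w) 0 i).
  by rewrite innovation_coord /=; ring.
under eq_fun do rewrite E.
have bM1 := bounded_measurableM (be' i) (b1 i).
have bM2 := bounded_measurableM (be' i) (b2 i).
rewrite (meanB _ bM1 (bounded_measurableZ _ bM2)) (meanZ _ _ bM2).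
by rewrite c1 c2 mulr0 subr0.
Qed.

Definition mse t := mean P (fun w => dot (err t w) (err t w)).

Lemma mse1 : (1 <= T)%N -> mse 1 <= 4 * G ^+ 2.
Proof.
move=> T1; rewrite -(mean_cst P (4 * G ^+ 2)); apply: le_mean => [||w].
- exact: err_sqr_bounded_measurable.
- exact: bounded_measurable_cst.
- by rewrite err1; apply: (noise_sqr p prob); exact: xK.
Qed.

(** The innovation is orthogonal to the past error, so the squared errors add
    up instead of the errors themselves. *)
Lemma mse_rec t (r m : R) : (2 <= t <= T)%N -> rho t = r -> 0 <= r <= 1 ->
  (forall w, enorm (x t w - x t.-1 w) <= r * m) ->
  mse t <= (1 - r) ^+ 2 * mse t.-1 + 8 * (L ^+ 2 * m ^+ 2 + G ^+ 2) * r ^+ 2.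
Proof.
move=> tT rt /andP[r0 r1] step; have tT' := tT.
case/andP: tT => t2 tT.
have t1T : (1 <= t.-1 <= T)%N by case: (t) t2 tT => // -[//|t'] _ /ltnW.
have be i := err_bounded_measurable i t1T.
have bI i : bounded_measurable (fun w => innovation t w 0 i).
  apply: (@sub_bounded_measurable _ _ _ (history_events z v t.+1)).
    exact: history_measurable iid _ _.
  exact: innovation_past.
have bee := err_sqr_bounded_measurable t1T.
have beI : bounded_measurable (fun w => dot (err t.-1 w) (innovation t w)).
  by apply: bounded_measurable_sum => i; exact: bounded_measurableM.
have bII : bounded_measurable (fun w => dot (innovation t w) (innovation t w)).
  by apply: bounded_measurable_sum => i; exact: bounded_measurableM.
have -> : mse t = (1 - r) ^+ 2 * mse t.-1
    + mean P (fun w => dot (innovation t w) (innovation t w)).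
  rewrite /mse (_ : (fun w => dot (err t w) (err t w)) = fun w =>
      ((1 - r) ^+ 2 * dot (err t.-1 w) (err t.-1 w)
        + 2 * (1 - r) * dot (err t.-1 w) (innovation t w))
      + dot (innovation t w) (innovation t w)); last first.
    apply/funext => w; rewrite (err_rec w tT') rt.
    move: (err t.-1 w) (innovation t w) => e u.
    rewrite !(dotDl, dotDr, dotZl, dotZr) (dotC u); ring.
  have bZ1 := bounded_measurableZ ((1 - r) ^+ 2) bee.
  have bZ2 := bounded_measurableZ (2 * (1 - r)) beI.
  rewrite (meanD _ (bounded_measurableD bZ1 bZ2) bII) (meanD _ bZ1 bZ2).
  by rewrite (meanZ _ _ bee) (meanZ _ _ beI) mean_err_innovation// mulr0 addr0.
rewrite lerD2l -(mean_cst P (8 * _ * _)); apply: le_mean => // [|w].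
  exact: bounded_measurable_cst.
have Kt : K (x t w) by apply: xK; rewrite (ltnW t2) leqW.
have Kt1 : K (x t.-1 w).
  by apply: xK; case/andP: t1T => -> /leqW.
rewrite /innovation rt; apply: le_trans (dot_add_le _ _) _.
have h1 := noise_diff_sqr p prob (z t w) Kt Kt1.
have h2 := noise_sqr p prob (z t w) Kt.
have h3 := dot_le_sqr (step w).
move: h1 h2 h3; set e := noise _ _ (x t w) _; set e' := noise _ _ _ _.
move: (x t w - x t.-1 w) => u; move: e e' => e e'.
rewrite !(dotZl, dotZr); move: (e - e') => e''.
have dd0 := dot_ge0 e''.
set dd := dot e'' _ in dd0 *; set nn := dot e _; set xx := dot u _ => h1 h2 h3.
have h4 : (1 - r) * ((1 - r) * dd) <= dd.
  by rewrite mulrA ler_piMl// mulr_ile1//; lra.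
have h5 : L ^+ 2 * xx <= L ^+ 2 * (r * m) ^+ 2 by rewrite ler_wpM2l// sqr_ge0.
have h6 : r ^+ 2 * nn <= r ^+ 2 * (4 * G ^+ 2) by rewrite ler_wpM2l// sqr_ge0.
have -> : r * (r * nn) = r ^+ 2 * nn by ring.
have E : 8 * (L ^+ 2 * m ^+ 2 + G ^+ 2) * r ^+ 2
    = 8 * (L ^+ 2 * (r * m) ^+ 2) + 2 * (r ^+ 2 * (4 * G ^+ 2)) by ring.
rewrite {}E; lra.
Qed.

End estimator_error.

(** * First-order inequalities *)

Section directional_limits.
Context (R : realType) (n : nat).
Implicit Types (f : 'rV[R]_n -> R) (x u g : 'rV[R]_n) (A : set 'rV[R]_n).

Lemma differentiable_right_quotient f x u : differentiable f x ->
  (f (x + h *: u) - f x) / h @[h --> 0^'+] --> dot (grad f x) u.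
Proof.
move=> df; rewrite -derive_grad//.
have du : derivable f x u by exact: diff_derivable.
apply: cvg_trans (cvg_app _ (@cvg_dnbhs_at_right _ _ _ _ _ du)).
by apply: near_eq_cvg; near=> h; rewrite /= [x + _]addrC [LHS]mulrC.
Unshelve. all: by end_near. Qed.

Lemma line_cvg x u (s : R) : (x + h *: u) @[h --> s] --> x + s *: u.
Proof.
by apply: cvgD; [exact: cvg_cst|apply: cvgZr_tmp; exact: cvg_id].
Qed.

(** A gradient within [A] only controls approaches inside [A]; the filter [Phi]
    is one-sided at a boundary point of [A] and two-sided in the interior of a
    segment. *)
Lemma within_quotient A f x g u (Phi : set_system R) : Filter Phi ->
  u != 0 -> Phi --> 0^' -> (\forall h \near Phi, A (x + h *: u)) ->
  has_gradient_within A f x g ->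
  (f (x + h *: u) - f x) / h @[h --> Phi] --> dot g u.
Proof.
move=> FPhi u0 Phi0 PhiA fg.
have un0 : 0 < enorm u.
  rewrite lt_neqAle enorm_ge0 andbT eq_sym; apply: contra u0 => /eqP u0.
  by apply/eqP/dot_eq0; rewrite -sqr_enorm u0 expr0n.
have Phine : \forall h \near Phi, h != 0.
  by apply: Phi0; exact: (nbhs_dnbhs_neq (0 : R)).
have line : (x + h *: u) @[h --> Phi] --> within A x^'.
  move=> S xS; have {}xS : nbhs x [set y | y != x -> A y -> S y] := xS.
  have Phi0' : Phi --> (0 : R) by apply: cvg_trans Phi0 _; exact: cvg_within.
  have lx : (x + h *: u) @[h --> Phi] --> x.
    have := @line_cvg x u 0; rewrite scale0r addr0; apply: cvg_trans.
    exact: cvg_app Phi0'.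
  have xSh : \forall h \near Phi,
      x + h *: u != x -> A (x + h *: u) -> S (x + h *: u) := lx _ xS.
  rewrite /nbhs /=; apply: filterS3 xSh Phine PhiA => h Sh h0 Ah; apply: Sh => //.
  by rewrite -subr_eq0 addrC addKr scaler_eq0 negb_or h0.
apply/cvgrPdist_le => e e0.
have /cvgrPdist_le/(_ (e / enorm u) (divr_gt0 e0 un0)) := cvg_comp _ _ line fg.
apply: filterS2 Phine => h h0 /=.
have -> : x + h *: u - x = h *: u by rewrite addrC addKr.
rewrite sub0r normrN dotZr enormZ normrM normfV normrM normr_id.
rewrite (ger0_norm (enorm_ge0 u)) ler_pdivrMr ?mulr_gt0 ?normr_gt0//.
have -> : e / enorm u * (`|h| * enorm u) = e * `|h| by field; rewrite gt_eqF.
have -> : dot g u - (f (x + h *: u) - f x) / h =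
    - ((f (x + h *: u) - f x - h * dot g u) / h) by field.
by rewrite normrN normrM normfV ler_pdivrMr ?normr_gt0.
Unshelve. all: by end_near. Qed.

End directional_limits.

Section dr_submodular.
Context (R : realType) (n : nat) (f : 'rV[R]_n -> R) (gf : 'rV[R]_n -> 'rV[R]_n).
Hypothesis f_cont : {within @orthant R n, continuous f}.
Hypothesis f_grad : forall x, orthant x ->
  has_gradient_within (@orthant R n) f x (gf x).
Hypothesis gf_antitone : forall x y, orthant x -> orthant y -> vle x y ->
  vle (gf y) (gf x).

Lemma orthant_line (x y : 'rV[R]_n) (s : R) : orthant x -> orthant y -> 0 <= s ->
  orthant (x + s *: y).
Proof.
move=> x0 y0 s0 i; rewrite !mxE addr_ge0//; first by have := x0 i; rewrite mxE.
by rewrite mulr_ge0//; have := y0 i; rewrite mxE.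
Qed.

(** Along a nonnegative direction the derivative is nonincreasing, so the
    objective is concave there and lies below its tangent. *)
Lemma dr_submodular_tangent (x y : 'rV[R]_n) : orthant x -> orthant y ->
  f (x + y) - f x <= dot (gf x) y.
Proof.
move=> x0 y0; have [->|yn0] := eqVneq y 0.
  by rewrite addr0 subrr -(scale0r x) dotZr mul0r.
have [||s] := @MVT_segment R (fun t => f (x + t *: y))
    (fun t => dot (gf (x + t *: y)) y) 0 1 ler01.
- move=> s; rewrite in_itv/= => /andP[s0 s1].
  have q : (f (x + s *: y + h *: y) - f (x + s *: y)) / h @[h --> 0^'] -->
      dot (gf (x + s *: y)) y.
    apply: within_quotient yn0 _ _ (f_grad (orthant_line x0 y0 (ltW s0))).
      exact: cvg_id.
    near=> h; rewrite -addrA -scalerDl; apply: orthant_line => //.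
    have : `|h| <= s by near: h; exact: dnbhs0_le.
    by rewrite ler_norml => /andP[]; lra.
  have E : (fun h : R => h^-1 *:
      (((fun t : R => f (x + t *: y)) \o shift s) (h *: 1) - f (x + s *: y))) =
    (fun h => (f (x + s *: y + h *: y) - f (x + s *: y)) / h).
    apply/funext => h /=; rewrite [LHS]mulrC; congr ((f _ - _) / _).
    by rewrite scalerDl addrAC addrA [h *: 1]mulr1.
  apply: DeriveDef; rewrite /derivable /derive E; last exact: cvg_lim q.
  by apply/cvg_ex; exists (dot (gf (x + s *: y)) y).
- apply/subspace_continuousP => s; rewrite /= in_itv/= => /andP[s0 s1].
  have /subspace_continuousP/(_ _ (orthant_line x0 y0 s0)) fs := f_cont.
  apply: (@cvg_comp _ _ _ (fun t : R => x + t *: y) f _ _ _ _ fs) => S xS.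
  have {}xS : nbhs (x + s *: y) [set q | orthant q -> S q] := xS.
  have lS : \forall t \near s, orthant (x + t *: y) -> S (x + t *: y).
    exact: (@line_cvg _ _ x y s _ xS).
  apply: filterS lS => t /= St t01; apply: St.
  by apply: orthant_line => //; move: t01; rewrite in_itv/= => /andP[].
rewrite in_itv/= => /andP[s0 s1]; rewrite scale1r scale0r addr0 subr0 mulr1 => ->.
apply: ler_sum => i _; rewrite ler_wpM2r//.
  by have := y0 i; rewrite mxE.
apply: gf_antitone => //; first exact: orthant_line.
move=> j; rewrite !mxE lerDl mulr_ge0//.
by have := y0 j; rewrite mxE.
Unshelve. all: by end_near. Qed.

End dr_submodular.

Section first_order.
Context (R : realType) (n : nat) d (Z : measurableType d).
Context (p : probability Z R) (K : set 'rV[R]_n) (Ft : 'rV[R]_n -> Z -> R).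
Context (D Rad B G L : R).
Hypothesis prob : stochastic_problem K Ft D Rad B G L.

Let F := mean_objective p Ft.
Let gF := mean_grad p Ft.

Lemma le_of_le_small (a b c : R) : 0 <= c ->
  (forall h, 0 < h <= 1 -> a <= b + h * c) -> a <= b.
Proof.
move=> c0 small; apply/ler_addgt0Pr => e e0.
pose h := Num.min 1 (e / (c + 1)).
have c1 : 0 < c + 1 by lra.
have h0 : 0 < h by rewrite lt_min ltr01 divr_gt0.
have h1 : h <= 1 by rewrite ge_min lexx.
have he : h * (c + 1) <= e by rewrite -ler_pdivlMr// ge_min lexx orbT.
have hab : a <= b + h * c by apply: small; rewrite h0.
by move: he; rewrite mulrDr mulr1; lra.
Qed.

(** Convexity on a segment of length ratio [h], compared with the expansion
    of the objective at the same point, gives the inequality up to a multiple of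
    [h], which is arbitrary. *)
Lemma convex_tangent x y :
  convex_function (K : set (convex_lmodType 'rV[R]_n)) F -> K x -> K y ->
  dot (gF x) (y - x) <= F y - F x.
Proof.
move=> cvxF Kx Ky; set u := y - x.
apply: (@le_of_le_small _ _ (`|L| * dot u u)) => [|h /andP[h0 h1]].
  by rewrite mulr_ge0// dot_ge0.
have h01 : Itv.spec (@Itv.num_sem R) (Itv.Real `[0%Z, 1%Z]) h.
  by rewrite /Itv.spec/= /Itv.num_sem/= in_itv/= ltW//= h1 gtr0_real.
have := cvxF (Itv.mk h01) _ _ (mem_set Ky) (mem_set Kx).
rewrite /conv/= /unstable.onem.
have -> : h *: y + (1 - h) *: x = x + h *: u.
  by rewrite scalerBl scalerBr scale1r addrC -addrA [- _ + _]addrC.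
move=> Fh0; have {Fh0}Fh : F (x + h *: u) <= h * F y + (1 - h) * F x := Fh0.
have Kh : K (x + h *: u) by apply: (segment_domain prob) => //; rewrite ltW.
have := objective_expansion p prob Kx Kh; rewrite -/F -/gF.
have -> : x + h *: u - x = h *: u by rewrite addrC addKr.
rewrite dotZr dotZl dotZr ler_norml => /andP[Fe _].
rewrite -(ler_pM2l h0); move: Fe Fh.
have -> : h * (F y - F x + h * (`|L| * dot u u)) =
   h * F y - h * F x + `|L| * (h * (h * dot u u)) by ring.
rewrite mulrBl mul1r; lra.
Qed.

Lemma grad_objective_direction x y : differentiable F x -> K x -> K y ->
  dot (grad F x) (y - x) = dot (gF x) (y - x).
Proof.
move=> dF Kx Ky; apply: (directional_derivative_unique prob Kx Ky).
exact: differentiable_right_quotient.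
Qed.

Lemma gradient_within_direction (A : set 'rV[R]_n) g x y : K `<=` A ->
  has_gradient_within A F x g -> K x -> K y ->
  dot g (y - x) = dot (gF x) (y - x).
Proof.
move=> KA Fg Kx Ky; have [->|yx0] := eqVneq (y - x) 0.
  by rewrite -(scale0r x) !dotZr !mul0r.
apply: (directional_derivative_unique prob Kx Ky).
apply: within_quotient yx0 _ _ Fg.
  move=> S S0; have {}S0 : nbhs (0 : R) [set h | h != 0 -> S h] := S0.
  by apply: filterS S0 => h Sh h0; apply: Sh; exact: lt0r_neq0.
near=> h; apply/KA/(segment_domain prob) => //; apply/andP; split.
  by near: h; apply: nbhs_right_ge.
by near: h; exact: nbhs_right_le.
Unshelve. all: by end_near. Qed.

(** The mean gradient at [x] is only tied to the orthant gradient along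
    directions that stay in the domain; [xs] is the difference of two of them,
    towards [xs] and towards the origin. *)
Lemma dr_submodular_ascent (x xs : 'rV[R]_n) : K `<=` @orthant R n -> K 0 ->
  DR_submodular F -> monotone_on_orthant F -> K x -> K xs ->
  F xs - F x <= dot (gF x) xs.
Proof.
move=> Korth K0 [Fcont _ [g [Fg ganti]]] Fmono Kx Kxs.
have ox := Korth _ Kx; have oxs := Korth _ Kxs.
have -> : dot (gF x) xs = dot (g x) xs.
  have := gradient_within_direction Korth (Fg _ ox) Kx Kxs.
  have := gradient_within_direction Korth (Fg _ ox) Kx K0.
  have dot0 u : dot u (0 : 'rV[R]_n) = 0.
    by rewrite -(scale0r (0 : 'rV[R]_n)) dotZr mul0r.
  by rewrite !dotBr !dot0; lra.
apply: le_trans (dr_submodular_tangent Fcont Fg ganti ox oxs).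
rewrite lerD2r; apply: Fmono => //.
  by have := orthant_line ox oxs ler01; rewrite scale1r.
by move=> i; rewrite !mxE lerDr; have := ox i; rewrite mxE.
Qed.

(** The oracle answer is at least as good for the estimate [g] as [y] is.
    Replacing [g] by the mean gradient in this comparison costs the product of
    the error [g - gF x] with [y - v], whose norm is at most [D]. *)
Lemma frank_wolfe_min_step x g v y (h c : R) : K x -> K y -> 0 < c ->
  0 <= h <= 1 -> minimizer K (fun u => dot u g) v ->
  F (x + h *: (v - x)) <= F x + h * dot (gF x) (y - x)
    + h * ((c * dot (g - gF x) (g - gF x) + D ^+ 2 / c) / 2)
    + `|L| * D ^+ 2 * h ^+ 2.
Proof.
move=> Kx Ky c0 h01 [Kv vmin].
have Kh : K (x + h *: (v - x)) by exact: (segment_domain prob).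
have := objective_expansion p prob Kx Kh; rewrite -/F -/gF.
have -> : x + h *: (v - x) - x = h *: (v - x) by rewrite addrC addKr.
rewrite ler_norml => /andP[_].
have := vmin _ Ky.
have young : dot (g - gF x) (y - v) <=
    (c * dot (g - gF x) (g - gF x) + D ^+ 2 / c) / 2.
  apply: le_trans (dot_young _ _ c0) _.
  rewrite ler_pM2r ?invr_gt0// lerD2l ler_pM2r ?invr_gt0//.
  by rewrite dot_le_sqr// (domain_dist prob).
have vx : `|L| * (h * (h * dot (v - x) (v - x))) <= `|L| * D ^+ 2 * h ^+ 2.
  have -> : `|L| * (h * (h * dot (v - x) (v - x))) =
    `|L| * dot (v - x) (v - x) * h ^+ 2 by ring.
  rewrite ler_wpM2r ?sqr_ge0// ler_wpM2l// dot_le_sqr//.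
  exact: (domain_dist prob).
case/andP: h01 => h0 _; move: young.
rewrite !dotZr dotZl; set dd := dot (g - _) (g - _).
set bound := (c * dd + _) / 2; set vv := dot (v - x) (v - x) in vx *.
rewrite !dotBr !dotBl (dotC y) (dotC v) => young opt.
have : h * (dot (gF x) v - dot (gF x) y) <= h * bound.
  by rewrite ler_wpM2l//; move: young opt; lra.
rewrite !mulrBr; move: vx; lra.
Qed.

(** Here the step is along [v] itself, so the quadratic term involves the
    radius; the error is still multiplied by a difference of two points of the
    domain. *)
Lemma frank_wolfe_max_step x g v y (h c : R) : K x -> K (x + h *: v) -> K y ->
  0 < c -> 0 <= h -> maximizer K (fun u => dot u g) v ->
  F x + h * dot (gF x) y
    - h * ((c * dot (g - gF x) (g - gF x) + D ^+ 2 / c) / 2)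
    - `|L| * Rad ^+ 2 * h ^+ 2 <= F (x + h *: v).
Proof.
move=> Kx Kh Ky c0 h0 [Kv vmax].
have := objective_expansion p prob Kx Kh; rewrite -/F -/gF.
have -> : x + h *: v - x = h *: v by rewrite addrC addKr.
rewrite ler_norml => /andP[+ _].
have := vmax _ Ky.
have young : dot (g - gF x) (v - y) <=
    (c * dot (g - gF x) (g - gF x) + D ^+ 2 / c) / 2.
  apply: le_trans (dot_young _ _ c0) _.
  rewrite ler_pM2r ?invr_gt0// lerD2l ler_pM2r ?invr_gt0//.
  by rewrite dot_le_sqr// (domain_dist prob).
have vx : `|L| * (h * (h * dot v v)) <= `|L| * Rad ^+ 2 * h ^+ 2.
  have -> : `|L| * (h * (h * dot v v)) = `|L| * dot v v * h ^+ 2 by ring.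
  rewrite ler_wpM2r ?sqr_ge0// ler_wpM2l// dot_le_sqr//.
  exact: (domain_norm prob).
move: young.
rewrite !dotZr dotZl; set dd := dot (g - _) (g - _).
set bound := (c * dd + _) / 2; set vv := dot v v in vx *.
rewrite !dotBr !dotBl (dotC y) (dotC v g) => young opt.
have : h * (dot (gF x) y - dot (gF x) v) <= h * bound.
  by rewrite ler_wpM2l//; move: young opt; lra.
rewrite !mulrBr; move: vx; lra.
Qed.

Lemma bounded_measurable_objective d' (T : measurableType d')
    (X : T -> 'rV[R]_n) : (forall w, K (X w)) ->
  (forall i, measurable_fun [set: T] (fun w => X w 0 i)) ->
  bounded_measurable (fun w => F (X w)).
Proof.
move=> KX mX; split; last first.
  by exists B => w; exact: (objective_bounded p prob).
apply: (@caratheodory_measurable _ _ _ T T _ K Rad (G + `|L| * D)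
  (fun x _ => F x)) => //; last exact: measurable_id.
- by move=> x i; exact: (domain_coord prob).
- by move=> x y _; exact: (objective_lipschitz p prob).
Qed.

End first_order.

(** * Numerical rates *)

Section rates.
Context (R : realType).

Definition cbrt (t : nat) : R := t%:R `^ 3^-1.

Lemma cbrt_ge0 t : 0 <= cbrt t. Proof. exact: powR_ge0. Qed.

Lemma cbrt_exp t : cbrt t ^+ 3 = t%:R.
Proof.
rewrite -powR_mulrn ?cbrt_ge0// -powRrM mulVf ?powRr1//.
Qed.

Lemma cbrt_gt0 t : (0 < t)%N -> 0 < cbrt t.
Proof. by move=> t0; rewrite powR_gt0// ltr0n. Qed.

Lemma cbrt_ge1 t : (0 < t)%N -> 1 <= cbrt t.
Proof.
move=> t0; rewrite leNgt; apply/negP => c1.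
have : cbrt t ^+ 3 < 1 by rewrite exprn_ilt1// cbrt_ge0.
by rewrite cbrt_exp ltNge ler1n t0.
Qed.

Lemma le_cbrt s t : (s <= t)%N -> cbrt s <= cbrt t.
Proof.
by move=> st; rewrite ge0_ler_powR ?invr_ge0 ?nnegrE ?ler0n ?ler_nat.
Qed.

Lemma powR_two_thirds t : (0 < t)%N -> t%:R `^ (- (2 / 3)) = (cbrt t ^+ 2)^-1 :> R.
Proof.
move=> t0; rewrite powRN; congr (_^-1).
by rewrite -powR_mulrn ?cbrt_ge0// -powRrM mulrC.
Qed.

Lemma powR_third t : t%:R `^ (- 3^-1) = (cbrt t)^-1 :> R.
Proof. by rewrite powRN. Qed.

Lemma powR_half t : t%:R `^ (- 2^-1) = (Num.sqrt t%:R)^-1 :> R.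
Proof. by rewrite powRN powR12_sqrt. Qed.

(** With [w] and [u] the cube roots of [t - 1] and [t], this compares an
    increment of [t^(2/3)] with [t^(-1/3)], which is its derivative up to a
    constant. *)
Lemma cube_root_gap (u w : R) : 0 <= w -> 0 < u -> u ^+ 3 = w ^+ 3 + 1 ->
  u ^+ 2 - w ^+ 2 <= u^-1 <= 2 * (u ^+ 2 - w ^+ 2).
Proof.
move=> w0 u0 uw.
have wu : w <= u.
  rewrite leNgt; apply/negP => uw'.
  have : u ^+ 3 < w ^+ 3 by rewrite ltrXn2r// ?ltW//.
  lra.
pose q := u ^+ 2 + u * w + w ^+ 2.
have uw0 : 0 <= u * w by rewrite mulr_ge0// ltW.
have q0 : 0 < q by rewrite /q -addrA ltr_pwDl ?exprn_gt0// addr_ge0// sqr_ge0.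
have E : u ^+ 2 - w ^+ 2 = (u + w) / q.
  have : (u - w) * q = 1.
    have -> : (u - w) * q = u ^+ 3 - w ^+ 3 by rewrite /q; ring.
    by rewrite uw addrAC subrr add0r.
  move=> h; apply: (canRL (mulfK (lt0r_neq0 q0))).
  have -> : (u ^+ 2 - w ^+ 2) * q = (u + w) * ((u - w) * q) by ring.
  by rewrite h mulr1.
rewrite E; apply/andP; split.
  rewrite ler_pdivrMr// mulrC ler_pdivlMr//.
  rewrite /q; have := sqr_ge0 w; lra.
rewrite mulrA ler_pdivlMr// mulrC ler_pdivrMr//.
have : w * w <= u * w by rewrite ler_wpM2r.
rewrite /q; have := sqr_ge0 u; lra.
Qed.

Lemma sum_inv_sqrt_step t :
  (Num.sqrt t.+1%:R)^-1 <= 2 * (Num.sqrt t.+1%:R - Num.sqrt t%:R) :> R.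
Proof.
set u := Num.sqrt t.+1%:R; set w := Num.sqrt t%:R.
have u0 : 0 < u by rewrite sqrtr_gt0.
have w0 : 0 <= w by exact: sqrtr_ge0.
have uE : u ^+ 2 = w ^+ 2 + 1 by rewrite !sqr_sqrtr// natr1.
have h := sqr_ge0 (u - w).
rewrite -(ler_pM2r u0) mulVf ?lt0r_neq0//.
move: uE h; rewrite !expr2 mulrBl !mulrBr; lra.
Qed.

Lemma inv_le_inv_sqrt t : t.+1%:R^-1 <= (Num.sqrt t.+1%:R)^-1 :> R.
Proof.
have s1 : 1 <= Num.sqrt t.+1%:R :> R by rewrite -[leLHS]sqrtr1 ler_wsqrtr// ler1n.
rewrite lef_pV2 ?posrE ?sqrtr_gt0 ?ltr0n//.
rewrite -[leRHS]sqr_sqrtr ?ler0n// expr2 ler_peMr// ltW//.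
Qed.

(** The weights [(t - 1) ^+ 2] turn the recursion into
    [s ^+ 2 * a s.+1 <= (s - 1) ^+ 2 * a s + kappa], whence [s * a s.+1 <= kappa]
    by induction.  The factor 2 passes from [t - 1] to [t]. *)
Lemma inverse_rate (a : nat -> R) (kappa : R) (T : nat) : 0 <= kappa ->
  a 1%N <= kappa ->
  (forall t, (2 <= t <= T)%N -> a t <=
    (1 - t.-1%:R^-1) ^+ 2 * a t.-1 + kappa * t.-1%:R^-1 ^+ 2) ->
  forall t, (1 <= t <= T)%N -> a t <= 2 * kappa / t%:R.
Proof.
move=> k0 a1 arec.
have claim s : (s.+1 <= T)%N -> s%:R * a s.+1 <= kappa.
  elim: s => [|s ih] sT; first by rewrite mul0r.
  have s0 : 0 < s.+1%:R :> R by [].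
  have := @arec s.+2 sT; rewrite /=.
  have -> : 1 - s.+1%:R^-1 = s%:R / s.+1%:R :> R.
    by rewrite -natr1; field; rewrite ?natr1 ?nat1r.
  rewrite -(ler_pM2l (exprn_gt0 2 s0)).
  have -> : s.+1%:R ^+ 2 * ((s%:R / s.+1%:R) ^+ 2 * a s.+1
     + kappa * s.+1%:R^-1 ^+ 2) = s%:R * (s%:R * a s.+1) + kappa.
    by field; rewrite nat1r.
  have ih' : s%:R * (s%:R * a s.+1) <= s%:R * kappa by rewrite ler_wpM2l// ih// ltnW.
  move=> h; rewrite -(ler_pM2l s0) mulrA -expr2.
  rewrite -natr1 mulrDl mul1r natr1; lra.
move=> [//|[|t]] tT; first by rewrite divr1; lra.
have := claim t.+1; move/andP: (tT) => [_ tT']; move=> /(_ tT').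
rewrite ler_pdivlMr ?ltr0n// => h.
have h2 : t.+2%:R <= 2 * t.+1%:R :> R.
  by rewrite -natrM ler_nat mul2n -addnn addSn addnS !ltnS leq_addr.
have [a0|a0] := leP 0 (a t.+2); last by apply: le_trans (_ : 0 <= _); [rewrite nmulr_rle0|rewrite mulr_ge0].
have : a t.+2 * t.+2%:R <= a t.+2 * (2 * t.+1%:R) by rewrite ler_wpM2l.
lra.
Qed.

(** The induction is on [a s.+2 <= 5 * kappa / cbrt s.+1 ^+ 2].  With [w] and
    [u] the cube roots of consecutive integers, its step amounts to
    [5 * (u ^+ 2 - 1) ^+ 2 + w ^+ 2 <= 5 * u ^+ 2 * w ^+ 2], which follows from
    [u ^+ 2 - w ^+ 2 <= 4 / 5].  The factor 2 between 5 and 10 passes from [t - 1]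
    to [t]. *)
Lemma two_thirds_rate (a : nat -> R) (kappa : R) (T : nat) : 0 <= kappa ->
  a 1%N <= kappa ->
  (forall t, (2 <= t <= T)%N -> a t <= (1 - (cbrt t.-1 ^+ 2)^-1) ^+ 2 * a t.-1
    + kappa * (cbrt t.-1 ^+ 2)^-1 ^+ 2) ->
  forall t, (1 <= t <= T)%N -> a t <= 10 * kappa / cbrt t ^+ 2.
Proof.
move=> k0 a1 arec.
have c1 : cbrt 1 = 1 by rewrite /cbrt powR1.
have claim s : (s.+2 <= T)%N -> a s.+2 <= 5 * kappa / cbrt s.+1 ^+ 2.
  elim: s => [|s ih] sT.
    have := @arec 2 sT; rewrite /= c1 !expr1n invr1 subrr expr0n mul0r add0r.
    by rewrite expr1n; lra.
  have := @arec s.+3 sT; rewrite /=.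
  set u := cbrt s.+2; set w := cbrt s.+1 in ih *.
  (* [5 / 4] lies below the cube root of 2 *)
  have u1 : 5 / 4 <= u.
    rewrite leNgt; apply/negP => uu.
    have : u ^+ 3 < (5 / 4) ^+ 3 by rewrite ltrXn2r ?cbrt_ge0.
    rewrite cbrt_exp; have : 2 <= s.+2%:R :> R by rewrite ler_nat.
    lra.
  have w1 : 1 <= w by exact: cbrt_ge1.
  have u0 : 0 < u by exact: cbrt_gt0.
  have w0 : 0 < w by exact: cbrt_gt0.
  have uw : u ^+ 3 = w ^+ 3 + 1 by rewrite !cbrt_exp natr1.
  have /andP[gap _] := cube_root_gap (ltW w0) u0 uw.
  have gap45 : u ^+ 2 - w ^+ 2 <= 4 / 5.
    apply: le_trans gap _; rewrite -(ler_pM2r u0) mulVf ?lt0r_neq0//; lra.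
  move=> h; apply: le_trans h _.
  have r01 : 0 <= (1 - (u ^+ 2)^-1) ^+ 2 by exact: sqr_ge0.
  have := ih (ltnW sT).
  move=> /(ler_wpM2l r01); rewrite -(lerD2r (kappa * (u ^+ 2)^-1 ^+ 2)) => h.
  apply: le_trans h _; rewrite -subr_ge0.
  have -> : 5 * kappa / u ^+ 2 - ((1 - (u ^+ 2)^-1) ^+ 2 * (5 * kappa / w ^+ 2)
      + kappa * (u ^+ 2)^-1 ^+ 2) =
      kappa * (5 * u ^+ 2 * w ^+ 2 - (5 * (u ^+ 2 - 1) ^+ 2 + w ^+ 2))
        / (u ^+ 4 * w ^+ 2).
    by field; rewrite !lt0r_neq0.
  apply: divr_ge0; last by rewrite mulr_ge0 ?exprn_ge0 ?cbrt_ge0.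
  apply: mulr_ge0 => //.
  have u21 : 1 <= u ^+ 2 by rewrite exprn_ege1//; lra.
  have w21 : 1 <= w ^+ 2 by rewrite exprn_ege1.
  have : (u ^+ 2 - 1) * (u ^+ 2 - 1) <= (u ^+ 2 - 1) * (w ^+ 2 - 1 / 5).
    by rewrite ler_wpM2l//; lra.
  move: (u ^+ 2) (w ^+ 2) u21 w21 {gap uw} gap45 => U W.
  rewrite expr2; lra.
move=> [//|[|[|t]]] tT.
- by rewrite c1 expr1n divr1; lra.
- have := claim 0%N; rewrite c1 expr1n divr1.
  move/andP: tT => [_ tT] /(_ tT) h; apply: le_trans h _.
  rewrite ler_pdivlMr ?exprn_gt0 ?cbrt_gt0//.
  have c2 : cbrt 2 ^+ 2 <= 2.
    by rewrite -[leRHS](cbrt_exp 2) ler_weXn2l// cbrt_ge1.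
  have : 5 * kappa * cbrt 2 ^+ 2 <= 5 * kappa * 2 by rewrite ler_wpM2l ?mulr_ge0.
  lra.
have := claim t.+1; move/andP: (tT) => [_ tT'] => /(_ tT') h; apply: le_trans h _.
set u := cbrt t.+3; set w := cbrt t.+2.
have u0 : 0 < u by exact: cbrt_gt0.
have w1 : 1 <= w by exact: cbrt_ge1.
have u1 : 1 <= u by exact: cbrt_ge1.
have uw : u ^+ 3 = w ^+ 3 + 1 by rewrite !cbrt_exp natr1.
have w0 : 0 < w by exact: cbrt_gt0.
have /andP[gap _] := cube_root_gap (ltW w0) u0 uw.
have u2w : u ^+ 2 <= 2 * w ^+ 2.
  have : u^-1 <= 1 by rewrite invf_le1.
  have : 1 <= w ^+ 2 by rewrite exprn_ege1.
  lra.
rewrite ler_pdivrMr ?exprn_gt0// mulrAC ler_pdivlMr ?exprn_gt0//.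
have : 5 * kappa * u ^+ 2 <= 5 * kappa * (2 * w ^+ 2) by rewrite ler_wpM2l ?mulr_ge0.
lra.
Qed.

Lemma sum_inv_cbrt T : \sum_(t < T) (cbrt t.+1)^-1 <= 2 * cbrt T ^+ 2.
Proof.
elim: T => [|T ih].
  by rewrite big_ord0 mulr_ge0// exprn_ge0// cbrt_ge0.
rewrite big_ord_recr /=.
have := @cube_root_gap (cbrt T.+1) (cbrt T) (cbrt_ge0 _) (cbrt_gt0 (ltn0Sn _)).
rewrite !cbrt_exp natr1 => /(_ erefl) /andP[_]; lra.
Qed.

(** The quantities [t * e t.+1] increase by at most [kappa / sqrt t], whose sum
    telescopes against [2 * kappa * sqrt t]. *)
Lemma decreasing_step_rate (e : nat -> R) (kappa : R) (T : nat) :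
  (forall t, (1 <= t <= T)%N -> t%:R * e t.+1 <=
    t.-1%:R * e t + kappa / Num.sqrt t%:R) -> 0 <= kappa -> (0 < T)%N ->
  e T.+1 <= 2 * kappa / Num.sqrt T%:R.
Proof.
move=> erec k0 T0.
have claim t : (t <= T)%N -> t%:R * e t.+1 <= kappa * (2 * Num.sqrt t%:R).
  elim: t => [|t ih] tT; first by rewrite mul0r mulr_ge0// mulr_ge0// sqrtr_ge0.
  apply: le_trans (erec t.+1 tT) _; rewrite /=.
  have := ih (ltnW tT); have := ler_wpM2l k0 (sum_inv_sqrt_step t).
  by rewrite !mulrBr; lra.
have := claim T (leqnn T).
have s0 : 0 < Num.sqrt T%:R :> R by rewrite sqrtr_gt0 ltr0n.
have TE : T%:R = Num.sqrt T%:R * Num.sqrt T%:R :> R by rewrite -expr2 sqr_sqrtr.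
move: s0 TE; set s := Num.sqrt _ => s0 ->.
by move=> h; rewrite ler_pdivlMr// -(ler_pM2l s0); lra.
Qed.

(** Each step contracts the initial value by [1 - 1 / T], which is at most
    [expR (- 1 / T)]; the perturbations are summed without contraction. *)
Lemma constant_step_rate (e : nat -> R) (kappa e1 : R) (T : nat) :
  (forall t, (1 <= t <= T)%N -> e t.+1 <=
    (1 - T%:R^-1) * e t + T%:R^-1 * (kappa / Num.sqrt t%:R)) ->
  0 <= kappa -> (0 < T)%N -> e 1%N <= e1 -> 0 <= e1 ->
  e T.+1 <= expR (- 1) * e1 + 2 * kappa / Num.sqrt T%:R.
Proof.
move=> erec k0 T0 e1le e10.
have T0' : 0 < T%:R :> R by rewrite ltr0n.
have q0 : 0 <= 1 - T%:R^-1 :> R by rewrite subr_ge0 invf_le1// ler1n.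
have q1 : 1 - T%:R^-1 <= 1 :> R by rewrite gerBl invr_ge0 ltW.
have claim t : (t <= T)%N -> e t.+1 <=
    (1 - T%:R^-1) ^+ t * e1 + T%:R^-1 * (kappa * (2 * Num.sqrt t%:R)).
  elim: t => [|t ih] tT; first by rewrite expr0 mul1r sqrtr0 !mulr0 addr0.
  apply: le_trans (erec t.+1 tT) _.
  have := ler_wpM2l q0 (ih (ltnW tT)); rewrite mulrDr mulrA -exprS.
  set S := T%:R^-1 * (kappa * (2 * Num.sqrt t%:R)).
  have S0 : 0 <= S by rewrite !mulr_ge0 ?invr_ge0 ?sqrtr_ge0// ltW.
  have := ler_piMl S0 q1.
  have : T%:R^-1 * (kappa / Num.sqrt t.+1%:R) <= T%:R^-1 * (kappa *
      (2 * Num.sqrt t.+1%:R)) - S.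
    rewrite /S -!mulrBr; apply: ler_wpM2l; first by rewrite invr_ge0 ltW.
    by apply: ler_wpM2l => //; exact: sum_inv_sqrt_step.
  lra.
apply: le_trans (claim T (leqnn T)) _; apply: lerD.
  rewrite ler_wpM2r//.
  have -> : - 1 = T%:R * (- T%:R^-1) :> R by rewrite mulrN mulfV// lt0r_neq0.
  rewrite expRM_natl lerXn2r ?nnegrE ?expR_ge0//.
  exact: expR_ge1Dx.
have s0 : 0 < Num.sqrt T%:R :> R by rewrite sqrtr_gt0.
have TE : T%:R = Num.sqrt T%:R * Num.sqrt T%:R :> R.
  by rewrite -expr2 sqr_sqrtr ?ltW.
move: s0 TE; set s := Num.sqrt _ => s0 ->.
rewrite le_eqVlt; apply/orP; left; apply/eqP.
by field; rewrite lt0r_neq0.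
Qed.

End rates.

(** * Runs of the algorithm: convex and DR-submodular objectives *)

Lemma mean_affine (R : realType) d (T : measurableType d) (P : probability T R)
    (f g : T -> R) (a b k : R) : bounded_measurable f -> bounded_measurable g ->
  mean P (fun w => a * f w + b * g w + k) = a * mean P f + b * mean P g + k.
Proof.
move=> bf bg; have baf := bounded_measurableZ a bf.
have bbg := bounded_measurableZ b bg.
rewrite (meanD _ (bounded_measurableD baf bbg) (bounded_measurable_cst _ k)).
by rewrite (meanD _ baf bbg) (meanZ _ _ bf) (meanZ _ _ bg) mean_cst.
Qed.

Lemma bounded_measurable_affine (R : realType) d (T : measurableType d)
    (f g : T -> R) (a b k : R) : bounded_measurable f -> bounded_measurable g ->
  bounded_measurable (fun w => a * f w + b * g w + k).
Proof.
move=> bf bg; have baf := bounded_measurableZ a bf.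
have bbg := bounded_measurableZ b bg.
exact: (bounded_measurableD (bounded_measurableD baf bbg)
  (bounded_measurable_cst _ k)).
Qed.

Section runs.
Context (R : realType) (n : nat) (dO dZ : measure_display).
Context (Omega : measurableType dO) (Z : measurableType dZ).
Context (P : probability Omega R) (p : probability Z R).
Context (K : set 'rV[R]_n) (Ft : 'rV[R]_n -> Z -> R) (D Rad B G L : R).
Context (T : nat) (rho eta : nat -> R) (x1 : 'rV[R]_n).
Context (z : nat -> {RV P >-> Z}) (v x g : nat -> Omega -> 'rV[R]_n).
Hypothesis prob : stochastic_problem K Ft D Rad B G L.
Hypothesis iid : iid_sampling p T z v.
Hypothesis T0 : (0 < T)%N.
Hypothesis Kx1 : K x1.

Let F := mean_objective p Ft.

(** An iterate is a combination of the starting point and of the oracle answers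
    of earlier iterations, which generate the past. *)
Lemma iterate_past (a b : nat -> R) :
  (forall w, x 1 w = x1) ->
  (forall t w, (1 <= t <= T)%N -> x t.+1 w = a t *: x t w + b t *: v t w) ->
  forall t i, (1 <= t <= T.+1)%N ->
    measurable_fun [set: past z v t] (fun w => x t w 0 i).
Proof.
move=> x1E xS; elim=> [//|[_ i _|t ih i /andP[_ tT]]].
  by under eq_fun do rewrite x1E; exact: measurable_cst.
have xE w : x t.+2 w 0 i = a t.+1 * x t.+1 w 0 i + b t.+1 * v t.+1 w 0 i.
  rewrite (xS t.+1 w tT); move: (x t.+1 w) (v t.+1 w) => y u.
  by rewrite !mxE.
under eq_fun do rewrite xE.
apply: measurable_funD; apply: measurable_funM; rewrite //.
  exact: history_mono (leqnSn _) (ih i (ltnW tT)).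
by apply: history_oracle; rewrite /= ltnSn.
Qed.

Lemma mse_inverse_rate (m : R) :
  sfw_estimator Ft rho T x1 z x g ->
  (forall t w, (1 <= t <= T.+1)%N -> K (x t w)) ->
  (forall t i, (1 <= t <= T.+1)%N ->
    measurable_fun [set: past z v t] (fun w => x t w 0 i)) ->
  (forall t, rho t = t.-1%:R^-1) ->
  (forall t w, (2 <= t <= T)%N -> enorm (x t w - x t.-1 w) <= t.-1%:R^-1 * m) ->
  forall t, (1 <= t <= T)%N ->
    mse P p Ft x g t <= 2 * (8 * (L ^+ 2 * m ^+ 2 + G ^+ 2)) / t%:R.
Proof.
move=> est xK xpast rhoE step.
have k0 : 0 <= 8 * (L ^+ 2 * m ^+ 2 + G ^+ 2).
  by rewrite mulr_ge0// addr_ge0 ?sqr_ge0// mulr_ge0 ?sqr_ge0.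
apply: inverse_rate => //.
  apply: le_trans (mse1 prob iid est xK xpast T0) _.
  by have := sqr_ge0 G; have := mulr_ge0 (sqr_ge0 L) (sqr_ge0 m); lra.
move=> t tT; apply: (mse_rec prob iid est xK xpast) => //.
  case/andP: tT; case: t => [//|[//|t]] _ _ /=.
  by rewrite invr_ge0 ler0n invf_le1// ler1n.
by move=> w; exact: step.
Qed.

Section min_run.
Hypothesis run : sfw_min_run K Ft rho eta T x1 z v x g.
Hypothesis eta01 : forall t, (1 <= t <= T)%N -> 0 <= eta t <= 1.

Lemma min_run_domain t w : (1 <= t <= T.+1)%N -> K (x t w).
Proof.
elim: t => [//|[_ _|t ih /andP[_ tT]]].
  by rewrite (sfw_start (sfw_min_estimator run)).
rewrite (sfw_min_step run w (t := t.+1))//.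
apply: (segment_domain prob) (ih (ltnW tT)) _ (eta01 _) => //.
by have [] := sfw_min_oracle run w (t := t.+1) tT.
Qed.

Lemma min_run_past t i : (1 <= t <= T.+1)%N ->
  measurable_fun [set: past z v t] (fun w => x t w 0 i).
Proof.
apply: (@iterate_past (fun t => 1 - eta t) eta) => [w|t' w tT'].
  by rewrite (sfw_start (sfw_min_estimator run)).
rewrite (sfw_min_step run w tT').
by rewrite scalerBr scalerBl scale1r [_ *: v _ _ - _]addrC addrA.
Qed.

Lemma min_run_step t w : (2 <= t <= T)%N ->
  enorm (x t w - x t.-1 w) <= eta t.-1 * D.
Proof.
case: t => [//|[//|t]] /andP[_ tT] /=; have tT' : (1 <= t.+1 <= T)%N by exact: ltnW.
rewrite (sfw_min_step run w tT') addrC addKr enormZ.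
have /andP[e0 _] := eta01 tT'; rewrite ger0_norm// ler_wpM2l//.
have [Kv _] := sfw_min_oracle run w tT'.
by apply: (domain_dist prob) => //; apply: min_run_domain; exact: leqW.
Qed.

End min_run.

Section max_run.
Hypothesis run : sfw_max_run K Ft rho (fun=> T%:R^-1) T x1 z v x g.
Hypothesis x10 : x1 = 0.

(** The average of the earlier oracle answers lies in the domain, and the
    iterate is this average scaled towards the origin. *)
Lemma max_run_average t w : (1 <= t <= T.+1)%N ->
  exists2 y, K y & x t w = (t.-1%:R / T%:R) *: y.
Proof.
have T0' : T%:R != 0 :> R by rewrite pnatr_eq0 -lt0n.
elim: t => [//|[_ _|t ih /andP[_ tT]]].
  exists x1 => //.
  by rewrite (sfw_start (sfw_max_estimator run)) mul0r scale0r.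
have [y Ky xE] := ih (ltnW tT).
have [Kv _] := sfw_max_oracle run w (t := t.+1) tT.
exists (y + t.+1%:R^-1 *: (v t.+1 w - y)).
  apply: (segment_domain prob) => //.
  by rewrite invr_ge0 ler0n invf_le1// ler1n.
rewrite (sfw_max_step run w (t := t.+1))// xE /=.
move: (v t.+1 w) => u.
apply/rowP => i; rewrite !mxE -natr1; field.
by rewrite T0' ?nat1r ?natr1 pnatr_eq0.
Qed.

Lemma max_run_domain t w : (1 <= t <= T.+1)%N -> K (x t w).
Proof.
move=> tT; have [y Ky ->] := max_run_average w tT.
rewrite -[_ *: y]add0r -[y in _ *: y]subr0 -x10.
apply: (segment_domain prob) => //.
rewrite divr_ge0//= ler_pdivrMr ?ltr0n// mul1r ler_nat.
by case: (t) tT => // t' /andP[].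
Qed.

Lemma max_run_past t i : (1 <= t <= T.+1)%N ->
  measurable_fun [set: past z v t] (fun w => x t w 0 i).
Proof.
apply: (@iterate_past (fun=> 1) (fun=> T%:R^-1)) => [w|t' w tT'].
  by rewrite (sfw_start (sfw_max_estimator run)).
by rewrite (sfw_max_step run w tT') scale1r.
Qed.

Lemma max_run_step t w : (2 <= t <= T)%N ->
  enorm (x t w - x t.-1 w) <= T%:R^-1 * Rad.
Proof.
case: t => [//|[//|t]] /andP[_ tT] /=; have tT' : (1 <= t.+1 <= T)%N by exact: ltnW.
rewrite (sfw_max_step run w tT') addrC addKr enormZ.
rewrite ger0_norm ?invr_ge0// ler_wpM2l ?invr_ge0//.
have [Kv _] := sfw_max_oracle run w tT'.
exact: (domain_norm prob).
Qed.

End max_run.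

Lemma bounded_measurable_iterate_objective t :
  (forall w, K (x t w)) ->
  (forall i, measurable_fun [set: past z v t] (fun w => x t w 0 i)) ->
  (t <= T.+1)%N -> bounded_measurable (fun w => F (x t w)).
Proof.
move=> xK xpast tT; apply: (bounded_measurable_objective p prob) => // i.
exact: (sub_measurable_fun (history_measurable iid tT) (xpast i)).
Qed.

End runs.

Section guarantees.
Context (R : realType) (n : nat) (dO dZ : measure_display).
Context (Omega : measurableType dO) (Z : measurableType dZ).
Context (P : probability Omega R) (p : probability Z R).
Context (K : set 'rV[R]_n) (Ft : 'rV[R]_n -> Z -> R) (D Rad B G L : R).
Context (T : nat) (x1 : 'rV[R]_n).
Context (z : nat -> {RV P >-> Z}) (v x g : nat -> Omega -> 'rV[R]_n).
Hypothesis prob : stochastic_problem K Ft D Rad B G L.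
Hypothesis iid : iid_sampling p T z v.
Hypothesis T0 : (0 < T)%N.
Hypothesis Kx1 : K x1.

Let F := mean_objective p Ft.

(** In iteration [t], Young's inequality is used with the weight [sqrt t], which
    balances a squared error of order [1 / t] against the constant
    [D ^+ 2]. *)
Lemma convex_min_rate xs :
  sfw_min_run K Ft (fun t => t.-1%:R^-1) (fun t => t%:R^-1) T x1 z v x g ->
  convex_function (K : set (convex_lmodType 'rV[R]_n)) F -> K xs ->
  mean P (fun w => F (x T.+1 w) - F xs) <=
    2 * (8 * (L ^+ 2 * D ^+ 2 + G ^+ 2) + D ^+ 2 / 2 + `|L| * D ^+ 2)
      / Num.sqrt T%:R.
Proof.
move=> run cvx Kxs.
have eta01 t : (1 <= t <= T)%N -> 0 <= (t%:R^-1 : R) <= 1.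
  by case/andP => t1 _; rewrite invr_ge0 ler0n/= invf_le1 ?ler1n ?ltr0n.
have xK t w := min_run_domain prob Kx1 run eta01 w (t := t).
have xpast t i := min_run_past run i (t := t).
set kappa := 8 * _.
have k0 : 0 <= kappa.
  by rewrite mulr_ge0// addr_ge0 ?sqr_ge0// mulr_ge0 ?sqr_ge0.
have LD0 : 0 <= `|L| * D ^+ 2 by rewrite mulr_ge0 ?sqr_ge0.
have D0 := sqr_ge0 D.
have msele := mse_inverse_rate prob iid T0 (sfw_min_estimator run) xK xpast (fun=> erefl)
  (fun t w => min_run_step prob Kx1 run eta01 w (t := t)).
have bF t : (1 <= t <= T.+1)%N -> bounded_measurable (fun w => F (x t w) - F xs).
  move=> tT; apply: bounded_measurableB; last exact: bounded_measurable_cst.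
  apply: (bounded_measurable_iterate_objective prob iid) => [w|i|].
  - exact: xK.
  - exact: xpast.
  - by case/andP: tT.
apply: (@decreasing_step_rate R (fun t => mean P (fun w => F (x t w) - F xs)))
  => //; last lra.
move=> [//|t] tT; set s := Num.sqrt _.
have t0 : 0 < t.+1%:R :> R by [].
have s0 : 0 < s by rewrite sqrtr_gt0.
have sE : t.+1%:R = s * s by rewrite -expr2 sqr_sqrtr.
have tTS : (1 <= t.+1 <= T.+1)%N by exact: leqW.
have tTS' : (1 <= t.+2 <= T.+1)%N by [].
have berr := err_sqr_bounded_measurable prob iid (sfw_min_estimator run) xK xpast tT.
have pointwise w : F (x t.+2 w) - F xs <=
    (1 - t.+1%:R^-1) * (F (x t.+1 w) - F xs)
    + (s / 2 / t.+1%:R) * dot (err p Ft x g t.+1 w) (err p Ft x g t.+1 w)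
    + (D ^+ 2 / s / 2 / t.+1%:R + `|L| * D ^+ 2 * t.+1%:R^-1 ^+ 2).
  have := frank_wolfe_min_step p prob (xK _ w tTS) Kxs s0 (eta01 _ tT)
    (sfw_min_oracle run w tT).
  rewrite -(sfw_min_step run w tT) -/F -/(err p Ft x g t.+1 w).
  have := convex_tangent prob cvx (xK _ w tTS) Kxs; rewrite -/F.
  have ti0 : 0 <= t.+1%:R^-1 :> R by rewrite invr_ge0.
  move=> /(ler_wpM2l ti0); move: (t.+1%:R^-1) (s^-1) => r q.
  set dd := dot (err _ _ _ _ _ _) _; set gg := dot _ _.
  move: (F (x t.+2 w)) (F (x t.+1 w)) (F xs) => f2 f1 fs; lra.
have := le_mean P (bF _ tTS') (bounded_measurable_affine _ _ _ (bF _ tTS) berr)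
  pointwise.
rewrite (mean_affine _ _ _ _ (bF _ tTS) berr).
set e := mean _ _; set e' := mean _ _.
have := msele _ tT; rewrite /mse -/kappa; set E := mean _ _ => Ele.
have {}Ele : s / 2 * E <= kappa / s.
  have -> : kappa / s = s / 2 * (2 * kappa / t.+1%:R).
    by rewrite sE; field; rewrite lt0r_neq0.
  by rewrite ler_wpM2l// divr_ge0// ltW.
have inv_s : `|L| * D ^+ 2 / t.+1%:R <= `|L| * D ^+ 2 / s.
  by rewrite ler_wpM2l// inv_le_inv_sqrt.
move=> rec; rewrite -pred_Sn.
have := ler_wpM2l (ltW t0) rec.
have -> : t.+1%:R * ((1 - t.+1%:R^-1) * e' + s / 2 / t.+1%:R * E +
    (D ^+ 2 / s / 2 / t.+1%:R + `|L| * D ^+ 2 * t.+1%:R^-1 ^+ 2)) =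
  t%:R * e' + s / 2 * E + (D ^+ 2 / s / 2 + `|L| * D ^+ 2 / t.+1%:R).
  have tS : t%:R = t.+1%:R - 1 :> R by rewrite -natr1 addrK.
  rewrite tS; move: (t.+1%:R : R) t0 => r r0; field.
  by rewrite !lt0r_neq0.
rewrite !mulrDl; move: Ele inv_s.
have -> : D ^+ 2 / s / 2 = D ^+ 2 / 2 / s by rewrite mulrAC.
move=> h1 h2 h3; apply: le_trans h3 _.
by rewrite -!addrA lerD2l lerD// lerD2l.
Qed.

(** The same balance as in the convex case; here [F xs - F (x t)] contracts by
    [1 - 1 / T] because the product of the mean gradient at [x t] with [xs] is at
    least [F xs - F (x t)]. *)
Lemma dr_submodular_max_rate xs :
  sfw_max_run K Ft (fun t => t.-1%:R^-1) (fun=> T%:R^-1) T x1 z v x g ->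
  x1 = 0 -> K `<=` @orthant R n -> DR_submodular F -> monotone_on_orthant F ->
  maximizer K F xs ->
  mean P (fun w => F xs - F (x T.+1 w)) <= expR (- 1) * F xs +
    2 * (8 * (L ^+ 2 * Rad ^+ 2 + G ^+ 2) + D ^+ 2 / 2 + `|L| * Rad ^+ 2)
      / Num.sqrt T%:R.
Proof.
move=> run x10 Korth DR Fmono [Kxs xsmax].
have K0 : K 0 by rewrite -x10.
have F0 y : K y -> 0 <= F y by move=> /Korth; case: DR => _ + _; exact.
have xK t w := max_run_domain prob T0 Kx1 run x10 w (t := t).
have xpast t i := max_run_past run i (t := t).
set kappa := 8 * _.
have k0 : 0 <= kappa.
  by rewrite mulr_ge0// addr_ge0 ?sqr_ge0// mulr_ge0 ?sqr_ge0.
have LD0 : 0 <= `|L| * Rad ^+ 2 by rewrite mulr_ge0 ?sqr_ge0.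
have D0 := sqr_ge0 D.
have T0' : 0 < T%:R :> R by rewrite ltr0n.
have Ti0 : 0 <= T%:R^-1 :> R by rewrite invr_ge0.
have step t w : (2 <= t <= T)%N -> enorm (x t w - x t.-1 w) <= t.-1%:R^-1 * Rad.
  move=> tT; apply: le_trans (max_run_step prob run w tT) _.
  rewrite ler_wpM2r ?(radius_ge0 prob)//.
  case: t tT => [//|[//|t]] /andP[_ tT].
  by rewrite lef_pV2 ?posrE ?ltr0n// ler_nat ltnW.
have msele := mse_inverse_rate prob iid T0 (sfw_max_estimator run) xK xpast (fun=> erefl) step.
have bF t : (1 <= t <= T.+1)%N -> bounded_measurable (fun w => F xs - F (x t w)).
  move=> tT; apply: bounded_measurableB; first exact: bounded_measurable_cst.
  apply: (bounded_measurable_iterate_objective prob iid) => [w|i|].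
  - exact: xK.
  - exact: xpast.
  - by case/andP: tT.
apply: (@constant_step_rate R (fun t => mean P (fun w => F xs - F (x t w))))
  => //; [|lra| |exact: F0]; last first.
  rewrite -[leRHS](mean_cst P); apply: le_mean => [||w].
  - exact: bF.
  - exact: bounded_measurable_cst.
  - by rewrite gerBl; apply: F0; exact: xK.
move=> [//|t] tT; set s := Num.sqrt _.
have t0 : 0 < t.+1%:R :> R by [].
have s0 : 0 < s by rewrite sqrtr_gt0.
have sE : t.+1%:R = s * s by rewrite -expr2 sqr_sqrtr.
have tTS : (1 <= t.+1 <= T.+1)%N by exact: leqW.
have tTS' : (1 <= t.+2 <= T.+1)%N by [].
have berr := err_sqr_bounded_measurable prob iid (sfw_max_estimator run) xK xpast tT.
have pointwise w : F xs - F (x t.+2 w) <=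
    (1 - T%:R^-1) * (F xs - F (x t.+1 w))
    + (T%:R^-1 * (s / 2)) * dot (err p Ft x g t.+1 w) (err p Ft x g t.+1 w)
    + T%:R^-1 * (D ^+ 2 / s / 2 + `|L| * Rad ^+ 2 / T%:R).
  have xS := sfw_max_step run w tT.
  have KxS : K (x t.+1 w + T%:R^-1 *: v t.+1 w) by rewrite -xS; exact: xK.
  have := frank_wolfe_max_step p prob (xK _ w tTS) KxS Kxs s0 Ti0
    (sfw_max_oracle run w tT).
  rewrite -xS -/F -/(err p Ft x g t.+1 w).
  have := dr_submodular_ascent prob Korth K0 DR Fmono (xK _ w tTS) Kxs.
  rewrite -/F => /(ler_wpM2l Ti0); move: (T%:R^-1) (s^-1) => r q.
  set dd := dot (err _ _ _ _ _ _) _; set gg := dot _ _.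
  move: (F (x t.+2 w)) (F (x t.+1 w)) (F xs) => f2 f1 fs; lra.
have := le_mean P (bF _ tTS') (bounded_measurable_affine _ _ _ (bF _ tTS) berr)
  pointwise.
rewrite (mean_affine _ _ _ _ (bF _ tTS) berr).
set e := mean _ _; set e' := mean _ _.
have := msele _ tT; rewrite /mse -/kappa; set E := mean _ _ => Ele.
have {}Ele : s / 2 * E <= kappa / s.
  have -> : kappa / s = s / 2 * (2 * kappa / t.+1%:R).
    by rewrite sE; field; rewrite lt0r_neq0.
  by rewrite ler_wpM2l// divr_ge0// ltW.
have inv_s : `|L| * Rad ^+ 2 / T%:R <= `|L| * Rad ^+ 2 / s.
  rewrite ler_wpM2l//; apply: le_trans (inv_le_inv_sqrt _ t).
  by rewrite lef_pV2 ?posrE ?ltr0n// ler_nat.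
move=> rec; apply: le_trans rec _; rewrite -addrA lerD2l.
rewrite -(mulrA _ (s / 2) E) -mulrDr ler_wpM2l//.
rewrite !mulrDl; move: Ele inv_s.
have -> : D ^+ 2 / s / 2 = D ^+ 2 / 2 / s by rewrite mulrAC.
by move=> h1 h2; rewrite -!addrA lerD// lerD2l.
Qed.

End guarantees.

(** * Runs of the algorithm: non-convex objectives *)

(** The integral of a nonnegative function is a supremum over the simple
    functions below it, so it is monotone even for a function whose
    measurability is not known.  This is applied to the gap at the random
    iterate. *)
Lemma expectation_le_dominating (R : realType) d (T : measurableType d)
    (P : probability T R) (f h : T -> R) :
  (forall w, 0 <= f w <= h w) -> bounded_measurable h ->
  ('E_P[f] <= (mean P h)%:E)%E.
Proof.
move=> fh bh; rewrite -meanE// unlock !ge0_integralTE => [|w|w].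
- apply: ereal_sup_le => _ [k /= kf <-]; exists k => //= w.
  by apply: le_trans (kf w) _; rewrite lee_fin; case/andP: (fh w).
- by rewrite lee_fin; case/andP: (fh w) => f0; exact: le_trans.
- by rewrite lee_fin; case/andP: (fh w).
Qed.

Section random_index.
Context (R : realType) (n : nat) (dO dZ : measure_display).
Context (Omega : measurableType dO) (Z : measurableType dZ).
Context (P : probability Omega R) (p : probability Z R) (T : nat).
Context (z : nat -> {RV P >-> Z}) (v : nat -> Omega -> 'rV[R]_n).
Context (o : {RV P >-> nat}).
Hypothesis iid : iid_sampling p T z v.
Hypothesis unif : uniform_index T z v o.

Lemma measurable_index t : measurable (o @^-1` [set t]).
Proof. exact: measurable_funPTI. Qed.

Lemma mean_indic_index t (U : Omega -> R) : (1 <= t <= T)%N ->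
  @bounded_measurable R _ (past z v T.+1) U ->
  mean P (fun w => \1_(o @^-1` [set t]) w * U w) = T%:R^-1 * mean P U.
Proof.
move=> tT bU.
have mid : @measurable_fun _ _ Omega (past z v T.+1) [set: Omega] (fun w => w).
  by move=> _ B mB; rewrite setTI; exact: (history_measurable iid (leqnn _)).
apply: (@mean_indic_comp _ _ _ _ (past z v T.+1) P (fun w => w)) => //.
- exact: measurable_index.
- move=> B mB; rewrite setIC (index_independent unif)//.
  by rewrite (index_uniform unif).
Qed.

Lemma index_select (U : nat -> Omega -> R) w :
  U (o w) w = \sum_(t < T) \1_(o @^-1` [set t.+1]) w * U t.+1 w.
Proof.
have := index_range unif w; case E : (o w) => [//|k] /andP[_ kT].
rewrite (bigD1 (Ordinal kT))//= indicE mem_set ?mul1r//=.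
rewrite big1 ?addr0// => t tk.
rewrite indicE memNset ?mul0r//= => oE.
by move/eqP: tk; apply; apply/val_inj; move: oE; rewrite /= E => -[].
Qed.

(** The index is independent of the past of iteration [T.+1], so each of its
    values selects [U t] with the weight [1 / T]. *)
Lemma mean_random_index (U : nat -> Omega -> R) :
  (forall t, (1 <= t <= T)%N -> @bounded_measurable R _ (past z v T.+1) (U t)) ->
  bounded_measurable (fun w => U (o w) w) /\
  mean P (fun w => U (o w) w) = T%:R^-1 * \sum_(t < T) mean P (U t.+1).
Proof.
move=> bU.
have tT (t : 'I_T) : (1 <= t.+1 <= T)%N by exact: ltn_ord.
have bU' (t : 'I_T) : bounded_measurable
    (fun w => \1_(o @^-1` [set t.+1]) w * U t.+1 w).
  apply: bounded_measurableM.
    exact/bounded_measurable_indic/measurable_index.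
  exact: (sub_bounded_measurable (history_measurable iid (leqnn _)) (bU _ (tT t))).
under eq_fun do rewrite index_select; split.
  exact: bounded_measurable_sum.
rewrite mean_sum// mulr_sumr; apply: eq_bigr => t _.
exact: mean_indic_index (tT t) (bU _ (tT t)).
Qed.

End random_index.

Section nonconvex.
Context (R : realType) (n : nat) (dO dZ : measure_display).
Context (Omega : measurableType dO) (Z : measurableType dZ).
Context (P : probability Omega R) (p : probability Z R).
Context (K : set 'rV[R]_n) (Ft : 'rV[R]_n -> Z -> R) (D Rad B G L : R).
Context (T : nat) (x1 : 'rV[R]_n).
Context (z : nat -> {RV P >-> Z}) (v x g : nat -> Omega -> 'rV[R]_n).
Context (o : {RV P >-> nat}).
Hypothesis prob : stochastic_problem K Ft D Rad B G L.
Hypothesis iid : iid_sampling p T z v.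
Hypothesis T0 : (0 < T)%N.
Hypothesis Kx1 : K x1.
Let F := mean_objective p Ft.
Hypothesis F_diff : forall y, K y -> differentiable F y.
Hypothesis run : sfw_min_run K Ft (fun t => t.-1%:R `^ (- (2 / 3)))
  (fun=> T%:R `^ (- (2 / 3))) T x1 z v x g.
Hypothesis unif : uniform_index T z v o.

Let eta : R := (cbrt R T ^+ 2)^-1.

Lemma eta_gt0 : 0 < eta.
Proof. by rewrite invr_gt0 exprn_gt0// cbrt_gt0. Qed.

Lemma nonconvex_eta01 t : (1 <= t <= T)%N ->
  0 <= (T%:R `^ (- (2 / 3)) : R) <= 1.
Proof.
move=> _; rewrite powR_two_thirds// ltW ?eta_gt0//=.
by rewrite invf_le1 ?exprn_gt0 ?cbrt_gt0// exprn_ege1// cbrt_ge1.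
Qed.

Lemma nonconvex_domain t w : (1 <= t <= T.+1)%N -> K (x t w).
Proof. exact: (min_run_domain prob Kx1 run nonconvex_eta01). Qed.

Lemma nonconvex_past t i : (1 <= t <= T.+1)%N ->
  measurable_fun [set: past z v t] (fun w => x t w 0 i).
Proof. exact: (min_run_past run). Qed.

Let kappa : R := 8 * (L ^+ 2 * D ^+ 2 + G ^+ 2).

Lemma kappa_ge0 : 0 <= kappa.
Proof. by rewrite mulr_ge0// addr_ge0 ?sqr_ge0// mulr_ge0 ?sqr_ge0. Qed.

Lemma nonconvex_mse t : (1 <= t <= T)%N ->
  mse P p Ft x g t <= 10 * kappa / cbrt R t ^+ 2.
Proof.
apply: (two_thirds_rate kappa_ge0) => [|{}t tT].
  apply: le_trans (mse1 prob iid (sfw_min_estimator run)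
    nonconvex_domain nonconvex_past T0) _.
  have := sqr_ge0 G; have := mulr_ge0 (sqr_ge0 L) (sqr_ge0 D).
  by rewrite /kappa; lra.
have t1 : (0 < t.-1)%N by case: (t) tT => // -[].
have c0 : 0 < cbrt R t.-1 by exact: cbrt_gt0.
apply: (mse_rec prob iid (sfw_min_estimator run)
  nonconvex_domain nonconvex_past) => //.
- exact: powR_two_thirds.
- by rewrite invr_ge0 exprn_ge0 ?cbrt_ge0//= invf_le1 ?exprn_gt0//
    exprn_ege1// cbrt_ge1.
- move=> w; apply: le_trans (min_run_step prob Kx1 run nonconvex_eta01 w tT) _.
  rewrite ler_wpM2r ?(diameter_ge0 prob)// powR_two_thirds//.
  rewrite lef_pV2 ?posrE ?exprn_gt0 ?cbrt_gt0//.
  rewrite lerXn2r ?nnegrE ?cbrt_ge0// le_cbrt//.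
  by case/andP: tT => _; apply: leq_trans; exact: leq_pred.
Qed.

(** The Frank-Wolfe step solved for the gap: a telescoping difference, the
    squared error weighted by [cbrt t] to balance its order [t^(-2/3)], and the
    quadratic term. *)
Definition gap_bound (t : nat) (w : Omega) : R :=
  eta^-1 * (F (x t w) - F (x t.+1 w))
  + cbrt R t / 2 * dot (err p Ft x g t w) (err p Ft x g t w)
  + (D ^+ 2 / 2 / cbrt R t + `|L| * D ^+ 2 * eta).

Lemma direction_le_gap_bound t w y : (1 <= t <= T)%N -> K y ->
  dot (y - x t w) (- grad F (x t w)) <= gap_bound t w.
Proof.
move=> tT Ky; have /andP[t1 tT'] := tT.
have Kx : K (x t w) by apply: nonconvex_domain; rewrite t1 leqW.
rewrite dotNr dotC (grad_objective_direction prob (F_diff Kx) Kx Ky).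
have xS := sfw_min_step run w tT.
have := frank_wolfe_min_step p prob Kx Ky (cbrt_gt0 R t1) (nonconvex_eta01 tT)
  (sfw_min_oracle run w tT).
rewrite -xS -/F -/(err p Ft x g t w) powR_two_thirds// -/eta /gap_bound.
have e0 := eta_gt0.
move=> step; rewrite -(ler_pM2l e0).
have -> : eta * (eta^-1 * (F (x t w) - F (x t.+1 w)) + cbrt R t / 2 *
    dot (err p Ft x g t w) (err p Ft x g t w)
    + (D ^+ 2 / 2 / cbrt R t + `|L| * D ^+ 2 * eta)) =
  F (x t w) - F (x t.+1 w) + eta * (cbrt R t / 2 *
    dot (err p Ft x g t w) (err p Ft x g t w)
    + D ^+ 2 / 2 / cbrt R t) + `|L| * D ^+ 2 * eta ^+ 2.
  move: e0; move: (eta) => e e0; field.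
  by rewrite !lt0r_neq0// cbrt_gt0.
move: step; set dd := dot (err _ _ _ _ _ _) _; set gg := dot _ _.
move: (F (x t w)) (F (x t.+1 w)) ((cbrt R t)^-1) => f1 f2 q; lra.
Qed.

Lemma fw_gap_le t w : (1 <= t <= T)%N ->
  0 <= fw_gap K F (x t w) <= gap_bound t w.
Proof.
move=> tT; have /andP[t1 tT'] := tT.
have Kx : K (x t w) by apply: nonconvex_domain; rewrite t1 leqW.
have bnd : ubound [set dot (y - x t w) (- grad F (x t w)) | y in K]
    (gap_bound t w).
  by move=> _ [y Ky <-]; exact: direction_le_gap_bound.
apply/andP; split; last by apply: ge_sup bnd; eexists; exists (x t w).
apply: (ub_le_sup (ex_intro _ _ bnd)); exists (x t w) => //.
by rewrite subrr -(scale0r (x t w)) dotZl mul0r.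
Qed.

Lemma objective_last t : (1 <= t <= T.+1)%N ->
  @bounded_measurable R _ (past z v T.+1) (fun w => F (x t w)).
Proof.
move=> /andP[t1 tT].
apply: (@bounded_measurable_objective _ _ _ _ p _ _ _ _ _ _ _ prob _
  (past z v T.+1)) => [w|i].
  by apply: nonconvex_domain; rewrite t1.
by apply: (history_mono tT); apply: nonconvex_past; rewrite t1.
Qed.

Lemma err_sqr_last t : (1 <= t <= T)%N ->
  @bounded_measurable R _ (past z v T.+1)
    (fun w => dot (err p Ft x g t w) (err p Ft x g t w)).
Proof.
move=> tT; apply: bounded_measurable_sum => i; set e := fun w => err p Ft x g t w 0 i.
have eb : @bounded_measurable R _ (past z v T.+1) e.
  have [me Me] := err_past p prob (sfw_min_estimator run)
    nonconvex_domain nonconvex_past i tT.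
  by split => //; apply: history_mono me; case/andP: tT.
exact: (bounded_measurableM eb eb).
Qed.

Lemma objective_diff_last t : (1 <= t <= T)%N ->
  @bounded_measurable R _ (past z v T.+1) (fun w => F (x t w) - F (x t.+1 w)).
Proof.
move=> /andP[t1 tT].
have b1 : @bounded_measurable R _ (past z v T.+1) (fun w => F (x t w)).
  by apply: objective_last; rewrite t1 leqW.
have b2 : @bounded_measurable R _ (past z v T.+1) (fun w => F (x t.+1 w)).
  exact: objective_last.
exact: (bounded_measurableB b1 b2).
Qed.

Lemma gap_bound_last t : (1 <= t <= T)%N ->
  @bounded_measurable R _ (past z v T.+1) (gap_bound t).
Proof.
move=> tT; exact: (bounded_measurable_affine _ _ _ (objective_diff_last tT)
  (err_sqr_last tT)).
Qed.

Lemma mean_gap_bound t : (1 <= t <= T)%N -> mean P (gap_bound t) <=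
  eta^-1 * (mean P (fun w => F (x t w)) - mean P (fun w => F (x t.+1 w)))
  + (5 * kappa + D ^+ 2 / 2) * (cbrt R t)^-1 + `|L| * D ^+ 2 * eta.
Proof.
move=> tT; have /andP[t1 tT'] := tT.
have sub := history_measurable iid (leqnn T.+1).
have bd := sub_bounded_measurable sub (objective_diff_last tT).
have be := sub_bounded_measurable sub (err_sqr_last tT).
have b1 : bounded_measurable (fun w => F (x t w)).
  by apply: (sub_bounded_measurable sub); apply: objective_last; rewrite t1 leqW.
have b2 : bounded_measurable (fun w => F (x t.+1 w)).
  by apply: (sub_bounded_measurable sub); exact: objective_last.
rewrite (mean_affine P _ _ _ bd be) (meanB P b1 b2).
have c0 := cbrt_gt0 R t1.
have : cbrt R t / 2 * mse P p Ft x g t <= 5 * kappa * (cbrt R t)^-1.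
  have -> : 5 * kappa * (cbrt R t)^-1 =
      cbrt R t / 2 * (10 * kappa / cbrt R t ^+ 2).
    by field; rewrite lt0r_neq0.
  by rewrite ler_wpM2l ?nonconvex_mse// divr_ge0// ltW.
rewrite /mse; set a := cbrt R t / 2 * mean _ _; set b := eta^-1 * (_ - _).
by move: a b ((cbrt R t)^-1) => a b q; lra.
Qed.

(** The telescoping differences add up to at most [2 * B]; since [eta] is
    [T^(-2/3)], dividing them by [eta * T] leaves the order [T^(-1/3)], which is
    also that of the average of the [1 / cbrt t]. *)
Lemma nonconvex_min_rate :
  ('E_P[fun w => fw_gap K F (x (o w) w)] <=
    ((2 * B + 2 * (5 * kappa + D ^+ 2 / 2) + `|L| * D ^+ 2)
      / cbrt R T)%:E)%E.
Proof.
have [bU mU] := mean_random_index iid unif gap_bound_last.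
have gap w : 0 <= fw_gap K F (x (o w) w) <= gap_bound (o w) w.
  by apply: fw_gap_le; exact: (index_range unif).
apply: le_trans (expectation_le_dominating P gap bU) _.
rewrite lee_fin mU.
set c := 5 * kappa + D ^+ 2 / 2; set l := `|L| * D ^+ 2.
have l0 : 0 <= l by rewrite mulr_ge0 ?sqr_ge0.
have c0 : 0 <= c.
  apply: addr_ge0; last by apply: divr_ge0; rewrite ?sqr_ge0.
  by apply: mulr_ge0 => //; exact: kappa_ge0.
pose f t := mean P (fun w => F (x t w)).
have sum_le : \sum_(t < T) mean P (gap_bound t.+1) <=
    \sum_(t < T) (eta^-1 * (f t.+1 - f t.+2) + c * (cbrt R t.+1)^-1 + l * eta).
  by apply: ler_sum => t _; apply: mean_gap_bound; exact: ltn_ord.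
have telescope m : \sum_(t < m) (f t.+1 - f t.+2) = f 1%N - f m.+1.
  elim: m => [|m ih]; first by rewrite big_ord0 subrr.
  by rewrite big_ord_recr/= ih addrA subrK.
have fB t : (1 <= t <= T.+1)%N -> `|f t| <= B.
  move=> tT; apply: normr_mean_le => [|w].
    have sub := history_measurable iid (leqnn T.+1).
    exact: (sub_bounded_measurable sub (objective_last tT)).
  by apply: (objective_bounded p prob); exact: nonconvex_domain.
have f1 := fB 1%N isT; have fT := fB T.+1 (leqnn _).
move: sum_le; rewrite big_split big_split /= -!mulr_sumr telescope.
rewrite sumr_const card_ord -[eta *+ T]mulr_natr => sum_le.
have Q0 := cbrt_gt0 R T0; have Q1 := cbrt_ge1 R T0.
have invsum := ler_wpM2l c0 (sum_inv_cbrt R T).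
have T0' : 0 < T%:R :> R by rewrite ltr0n.
rewrite mulrC ler_pdivrMr//; apply: le_trans sum_le _.
rewrite -cbrt_exp /eta invrK; set Q := cbrt R T in Q0 Q1 invsum *.
have -> : l * ((Q ^+ 2)^-1 * Q ^+ 3) = l * Q by field; rewrite lt0r_neq0.
have -> : (2 * B + 2 * c + l) / Q * Q ^+ 3 =
    Q ^+ 2 * (2 * B) + c * (2 * Q ^+ 2) + l * Q ^+ 2.
  by field; rewrite lt0r_neq0.
have fle : Q ^+ 2 * (f 1%N - f T.+1) <= Q ^+ 2 * (2 * B).
  rewrite ler_wpM2l ?sqr_ge0//.
  by move: f1 fT; rewrite !ler_norml => /andP[? ?] /andP[? ?]; lra.
have lQ : l * Q <= l * Q ^+ 2 by rewrite ler_wpM2l// expr2 ler_peMr// ltW.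
lra.
Qed.

End nonconvex.

(** * The convergence theorem *)

Theorem theorem4 (R : realType) :
  (* 1: convex minimization *)
  (exists C : R -> R -> R -> R -> R -> R,
    forall (d : nat) (dZ : measure_display) (Z : measurableType dZ)
      (p : probability Z R) (K : set 'rV[R]_d) (Ft : 'rV[R]_d -> Z -> R)
      (D Rad B G L : R) (dO : measure_display) (Omega : measurableType dO)
      (P : probability Omega R) (T : nat) (x1 : 'rV[R]_d)
      (z : nat -> {RV P >-> Z}) (v x g : nat -> Omega -> 'rV[R]_d),
    let F := mean_objective p Ft in
    stochastic_problem K Ft D Rad B G L ->
    (0 < T)%N ->
    K x1 ->
    iid_sampling p T z v ->
    convex_function (K : set (convex_lmodType 'rV[R]_d)) F ->
    sfw_min_run K Ft (fun t => (t.-1)%:R^-1) (fun t => t%:R^-1) T x1 z v x g ->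
    (forall w, K (x T.+1 w)) /\
    (forall xs, minimizer K F xs ->
      ('E_P[fun w => (F (x T.+1 w) - F xs)%R]
         <= (C D Rad B G L * T%:R `^ (- 2^-1))%:E)%E))
  /\
  (* 2: non-convex minimization *)
  (exists C : R -> R -> R -> R -> R -> R,
    forall (d : nat) (dZ : measure_display) (Z : measurableType dZ)
      (p : probability Z R) (K : set 'rV[R]_d) (Ft : 'rV[R]_d -> Z -> R)
      (D Rad B G L : R) (dO : measure_display) (Omega : measurableType dO)
      (P : probability Omega R) (T : nat) (x1 : 'rV[R]_d)
      (z : nat -> {RV P >-> Z}) (v x g : nat -> Omega -> 'rV[R]_d)
      (o : {RV P >-> nat}),
    let F := mean_objective p Ft in
    stochastic_problem K Ft D Rad B G L ->
    (0 < T)%N ->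
    K x1 ->
    iid_sampling p T z v ->
    (forall y, K y -> differentiable F y) ->
    sfw_min_run K Ft (fun t => (t.-1)%:R `^ (- (2 / 3)))
      (fun _ => T%:R `^ (- (2 / 3))) T x1 z v x g ->
    uniform_index T z v o ->
    (forall w, K (x (o w) w)) /\
    ('E_P[fun w => fw_gap K F (x (o w) w)]
       <= (C D Rad B G L * T%:R `^ (- 3^-1))%:E)%E)
  /\
  (* 3: monotone DR-submodular maximization *)
  (exists C : R -> R -> R -> R -> R -> R,
    forall (d : nat) (dZ : measure_display) (Z : measurableType dZ)
      (p : probability Z R) (K : set 'rV[R]_d) (Ft : 'rV[R]_d -> Z -> R)
      (D Rad B G L : R) (dO : measure_display) (Omega : measurableType dO)
      (P : probability Omega R) (T : nat)
      (z : nat -> {RV P >-> Z}) (v x g : nat -> Omega -> 'rV[R]_d),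
    let F := mean_objective p Ft in
    stochastic_problem K Ft D Rad B G L ->
    (0 < T)%N ->
    K `<=` @orthant R d ->
    K 0 ->
    iid_sampling p T z v ->
    DR_submodular F ->
    monotone_on_orthant F ->
    sfw_max_run K Ft (fun t => (t.-1)%:R^-1) (fun _ => T%:R^-1) T 0 z v x g ->
    (forall w, K (x T.+1 w)) /\
    (forall xs, maximizer K F xs ->
      (((1 - expR (- 1)) * F xs - C D Rad B G L * T%:R `^ (- 2^-1))%:E
         <= 'E_P[fun w => F (x T.+1 w)])%E)).
Proof.
split; [|split].
- exists (fun D Rad B G L =>
    2 * (8 * (L ^+ 2 * D ^+ 2 + G ^+ 2) + D ^+ 2 / 2 + `|L| * D ^+ 2)).
  move=> d dZ Z p K Ft D Rad B G L dO Omega P T x1 z v x g F prob T0 Kx1 iid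
    cvx run.
  have eta01 t : (1 <= t <= T)%N -> 0 <= (t%:R^-1 : R) <= 1.
    by case/andP => t1 _; rewrite invr_ge0 ler0n/= invf_le1 ?ler1n ?ltr0n.
  have xK w : K (x T.+1 w).
    by apply: (min_run_domain prob Kx1 run eta01); rewrite ltnSn.
  split => // xs [Kxs _].
  have bF : bounded_measurable (fun w => F (x T.+1 w) - F xs).
    apply: bounded_measurableB; last exact: bounded_measurable_cst.
    apply: (bounded_measurable_iterate_objective prob iid) => // i.
    by apply: (min_run_past run); rewrite ltnSn.
  rewrite (meanE P bF) lee_fin powR_half.
  exact: (convex_min_rate prob iid T0 Kx1 run cvx Kxs).
- exists (fun D Rad B G L =>
    2 * B + 2 * (5 * (8 * (L ^+ 2 * D ^+ 2 + G ^+ 2)) + D ^+ 2 / 2)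
      + `|L| * D ^+ 2).
  move=> d dZ Z p K Ft D Rad B G L dO Omega P T x1 z v x g o F prob T0 Kx1 iid
    F_diff run unif.
  split; last first.
    rewrite powR_third.
    exact: (nonconvex_min_rate prob iid T0 Kx1 F_diff run unif).
  move=> w; apply: (nonconvex_domain prob T0 Kx1 run).
  by have /andP[-> /leqW] := index_range unif w.
- exists (fun D Rad B G L =>
    2 * (8 * (L ^+ 2 * Rad ^+ 2 + G ^+ 2) + D ^+ 2 / 2 + `|L| * Rad ^+ 2)).
  move=> d dZ Z p K Ft D Rad B G L dO Omega P T z v x g F prob T0 Korth K0 iid
    DR Fmono run.
  have xK w : K (x T.+1 w).
    by apply: (max_run_domain prob T0 K0 run erefl); rewrite ltnSn.
  split => // xs xsmax.
  have bF : bounded_measurable (fun w => F (x T.+1 w)).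
    apply: (bounded_measurable_iterate_objective prob iid) => // i.
    by apply: (max_run_past run); rewrite ltnSn.
  have := dr_submodular_max_rate prob iid T0 K0 run erefl Korth DR Fmono xsmax.
  rewrite (meanB P (bounded_measurable_cst _ (F xs)) bF) mean_cst => rate.
  rewrite (meanE P bF) lee_fin powR_half mulrBl mul1r.
  by move: rate; set s := (Num.sqrt _)^-1; rewrite -/F; lra.
Qed.
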